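(* Let $(G,L)$ be a rational structure for the group $G$, for which Stallings-like graphs for $L$-quasi-convex subgroups are computable. Assume also that each element of $G$ has a finite number of $L$-representatives. Then there is a partial algorithm which solves the finiteness problem for $L$-quasi-convex subgroups of $G$. If the rational structure $(G,L)$ is induced by an automatic structure, then this algorithm is uniform in the automatic structure.
   Context: Let $A$ be a finite alphabet with at least two letters, $\tilde A = A\cup A^{-1}$, $\tilde A^*$ the free monoid on $\tilde A$, and $F(A)\subset \tilde A^*$ the set of reduced words. $G$ is a group with an epimorphism $\mu\colon\tilde A^*\to G$ respecting inverses. Reduced words $h_1,\dots,h_s$ ''generate the subgroup $H$ of $G$'' if $H=\langle \mu(h_1),\dots,\mu(h_s)\rangle$. Rational structure $(G,L)$: $L\subseteq\tilde A^*$ is a language accepted by a finite automaton, consisting of reduced words, with $\mu(L)=G$. An $L$-representative of $g\in G$ is an element of $L\cap\mu^{-1}(g)$. Automatic structure: a finite automaton accepting a language $L$ of reduced words with $\mu(L)=G$ and, for each $a\in\tilde A\cup\{1\}$, a finite automaton accepting (with padding of the shorter word at its right end by a new symbol) the set of pairs $(u,v)\in L\times L$ with $\mu(ua)=\mu(v)$. It induces the rational structure $(G,L)$. $L$-quasi-convexity: $H\le G$ is $L$-quasi-convex if there is an integer $k$ such that for every $w\in L\cap\mu^{-1}(H)$, the path in the Cayley graph of $G$ (with respect to $A$) starting at $1$ and labeled $w$ stays within distance at most $k$ of $H$. Stallings-like graphs: an $A$-graph is a directed graph with edges labeled by letters of $A$; $a^{-1}$ is read by traversing an $a$-edge backwards.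 A reduced rooted graph $(\Gamma,v)$ is a connected $A$-graph with base vertex $v$ that is folded (distinct edges with the same initial vertex, or the same terminal vertex, have distinct labels) and in which every vertex except perhaps $v$ is incident to at least two edges. $(\Gamma,v)$ is Stallings-like for $H$ with respect to $L$ if every loop at $v$ is labeled by a word in $\mu^{-1}(H)$ and every $L$-representative of an element of $H$ labels a loop at $v$. Stallings-like graphs are computable for $L$-quasi-convex subgroups if there is a partial algorithm which, given finitely many reduced words generating a subgroup $H$, stops and computes a (finite) Stallings-like graph for $H$ with respect to $L$ if $H$ is $L$-quasi-convex, and never stops otherwise. Finiteness problem: given a tuple of reduced words generating a subgroup $H$ of $G$, decide whether $H$ is finite. A partial algorithm solves a problem for $L$-quasi-convex subgroups if it terminates, with the correct answer, exactly when the subgroups determined by the input are $L$-quasi-convex, and runs forever otherwise. It is uniform in the automatic structure if there is a single partial algorithm which takes as input both an automatic structure inducing $(G,L)$ and the input of the problem, and solves it. *)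

(* Defs.v *)
From HB Require Import structures.
From mathcomp Require Import all_boot.
From mathcomp Require Import boolp classical_sets functions cardinality.

Set Implicit Arguments.
Unset Strict Implicit.
Unset Printing Implicit Defensive.

Local Open Scope classical_set_scope.

(* Partial algorithms are programs of the WHILE language over binary trees
   (N. D. Jones, "Computability and Complexity from a Programming
   Perspective"), in point-free form: a program transforms one tree, which
   holds its whole memory.  This model is Turing-complete.  In tests, Leaf is
   false and every other tree is true. *)
Inductive tree := Leaf | Node of tree & tree.

Definition hd (t : tree) := if t is Node l _ then l else Leaf.
Definition tl (t : tree) := if t is Node _ r then r else Leaf.

Inductive prog :=
| PId
| PLeaf
| PHd
| PTl
| PNode of prog & prog          (* run both on the input, pair the results *)
| PSeq of prog & prog           (* the first, then the second *)
| PIf of prog & prog & prog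
| PWhile of prog & prog.        (* test, body *)

Inductive eval : prog -> tree -> tree -> Prop :=
| EId x : eval PId x x
| ELeaf x : eval PLeaf x Leaf
| EHd x : eval PHd x (hd x)
| ETl x : eval PTl x (tl x)
| ENode p q x y z : eval p x y -> eval q x z -> eval (PNode p q) x (Node y z)
| ESeq p q x y z : eval p x y -> eval q y z -> eval (PSeq p q) x z
| EIfT c p q x l r y :
    eval c x (Node l r) -> eval p x y -> eval (PIf c p q) x y
| EIfF c p q x y : eval c x Leaf -> eval q x y -> eval (PIf c p q) x y
| EWhileT c p x l r y z :
    eval c x (Node l r) -> eval p x y -> eval (PWhile c p) y z ->
    eval (PWhile c p) x z
| EWhileF c p x : eval c x Leaf -> eval (PWhile c p) x x.

Definition halts (p : prog) (x : tree) : Prop := exists y, eval p x y.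

Lemma eval_det p x y z : eval p x y -> eval p x z -> y = z.
Proof.
move=> pxy; elim: pxy z => {p x y};
  by intros; match goal with H : eval _ _ ?z |- _ = ?z => inversion H end;
    subst; repeat match goal with
      | IH : forall z, eval ?p ?x z -> ?y = z, E : eval ?p ?x _ |- _ =>
          pose proof (IH _ E); clear E; subst; try discriminate
    end.
Qed.

(* p is a partial algorithm for the problem "given i, valid, compute some o
   with spec i o": it stops, with a correct answer, when dom i holds, and runs
   forever on the other valid inputs. *)
Definition partially_solves (I O : Type) (p : prog)
    (encI : I -> tree) (encO : O -> tree)
    (valid dom : I -> Prop) (spec : I -> O -> Prop) : Prop :=
  forall i, valid i ->
    (dom i -> exists2 o, spec i o & eval p (encI i) (encO o)) /\
    (~ dom i -> ~ halts p (encI i)).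

Definition enc_bool (b : bool) : tree := if b then Node Leaf Leaf else Leaf.
Definition enc_nat (n : nat) : tree := iter n (Node Leaf) Leaf.
Definition enc_seq (T : Type) (enc : T -> tree) (s : seq T) : tree :=
  foldr (fun x => Node (enc x)) Leaf s.
Definition enc_option (T : Type) (enc : T -> tree) (o : option T) : tree :=
  if o is Some x then Node Leaf (enc x) else Leaf.
Definition enc_pair (S T : Type) (encS : S -> tree) (encT : T -> tree)
  (x : S * T) : tree := Node (encS x.1) (encT x.2).

(* The alphabet A u A^-1: (a, false) is a and (a, true) is its inverse. *)
Definition letter (A : finType) : finType := (A * bool)%type.
Definition word (A : finType) : Type := seq (letter A).

Definition inv_letter (A : finType) (x : letter A) : letter A := (x.1, ~~ x.2).

Definition reduced (A : finType) (w : word A) : bool :=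
  sorted (fun x y => y != inv_letter x) w.

(* Letters are identified by their rank in the enumeration of the alphabet. *)
Definition enc_letter (A : finType) : letter A -> tree :=
  enc_pair (fun a => enc_nat (enum_rank a)) enc_bool.
Definition enc_word (A : finType) : word A -> tree := enc_seq (@enc_letter A).

(* A nondeterministic automaton.  States are natural numbers; the state set,
   implicit, is the finite set of the numbers which occur. *)
Record automaton (S : eqType) := Automaton {
  initial : seq nat;
  final : seq nat;
  transitions : seq (nat * S * nat)
}.

Fixpoint reads (S : Type) (step : nat -> S -> nat -> Prop)
    (p : nat) (w : seq S) (q : nat) : Prop :=
  if w is x :: w' then exists2 r, step p x r & reads step r w' q else p = q.

Definition accepted (S : eqType) (M : automaton S) : set (seq S) :=
  [set w | exists p q, [/\ p \in initial M, q \in final M &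
     reads (fun r x s => (r, x, s) \in transitions M) p w q]].

Definition enc_automaton (S : eqType) (enc : S -> tree) (M : automaton S) :
    tree :=
  Node (enc_seq enc_nat (initial M))
    (Node (enc_seq enc_nat (final M))
      (enc_seq (enc_pair (enc_pair enc_nat enc) enc_nat) (transitions M))).

Section Group.
Variables (A : finType) (G : groupType).
Implicit Types (mu : word A -> G) (L : set (word A)) (H : set G).

Definition marking mu : Prop :=
  [/\ mu [::] = 1%g,
      forall u v, mu (u ++ v) = (mu u * mu v)%g,
      forall x, mu [:: inv_letter x] = ((mu [:: x])^-1)%g &
      forall g, exists w, mu w = g].

Definition subgroup H : Prop :=
  [/\ H 1%g, forall g h, H g -> H h -> H (g * h)%g &
      forall g, H g -> H (g^-1)%g].

Definition generated mu (hs : seq (word A)) : set G :=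
  smallest subgroup [set mu h | h in [set` hs]].

Definition rational_structure mu L : Prop :=
  [/\ exists M : automaton (letter A), accepted M = L,
      forall w, L w -> reduced w &
      mu @` L = setT].

Definition finitely_many_representatives mu L : Prop :=
  forall g, finite_set (L `&` mu @^-1` [set g]).

(* The vertices of the path of the Cayley graph starting at 1 and labeled w
   are the images of the prefixes of w; the vertex g is at distance at most k
   from the vertex h when h = g * mu x for a word x of length at most k. *)
Definition quasi_convex mu L H : Prop :=
  exists k : nat, forall w, L w -> H (mu w) ->
    forall i, i <= size w ->
      exists2 h, H h &
        exists2 x : word A, size x <= k & h = (mu (take i w) * mu x)%g.

End Group.

(* A finite A-graph with a base vertex; the edge (x, a, y) goes from x to y
   and is labeled a.  Lists stand for the sets of their elements. *)
Record rooted_graph (A : finType) := RootedGraph {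
  base : nat;
  vertices : seq nat;
  edges : seq (nat * A * nat)
}.

Section Graph.
Variable A : finType.
Implicit Types (Gamma : rooted_graph A) (e : nat * A * nat).

Definition source e : nat := e.1.1.
Definition label e : A := e.1.2.
Definition target e : nat := e.2.

Definition labels_path Gamma : nat -> word A -> nat -> Prop :=
  reads (fun x (l : letter A) y =>
    if l.2 then (y, l.1, x) \in edges Gamma else (x, l.1, y) \in edges Gamma).

Definition labels_loop Gamma (w : word A) : Prop :=
  labels_path Gamma (base Gamma) w (base Gamma).

Definition rooted_graph_wf Gamma : Prop :=
  base Gamma \in vertices Gamma /\
  (forall e, e \in edges Gamma ->
     source e \in vertices Gamma /\ target e \in vertices Gamma).

Definition connected Gamma : Prop :=
  forall x y, x \in vertices Gamma -> y \in vertices Gamma ->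
    exists w, labels_path Gamma x w y.

Definition folded Gamma : Prop :=
  forall e e', e \in edges Gamma -> e' \in edges Gamma -> e <> e' ->
    source e = source e' \/ target e = target e' -> label e <> label e'.

(* A vertex other than the base carrying a one-edge loop also has, by
   connectedness, an edge which is not a loop: it does not matter whether the
   loop counts once or twice in the last clause. *)
Definition reduced_rooted Gamma : Prop :=
  [/\ rooted_graph_wf Gamma, connected Gamma, folded Gamma &
      forall x, x \in vertices Gamma -> x <> base Gamma ->
        exists e e', [/\ e \in edges Gamma, e' \in edges Gamma, e <> e',
          source e = x \/ target e = x & source e' = x \/ target e' = x]].

Definition stallings_like (G : groupType) (mu : word A -> G)
    (L : set (word A)) (H : set G) Gamma : Prop :=
  [/\ reduced_rooted Gamma,
      forall w, labels_loop Gamma w -> H (mu w) &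
      forall w, L w -> H (mu w) -> labels_loop Gamma w].

Definition enc_rooted_graph Gamma : tree :=
  Node (enc_nat (base Gamma))
    (Node (enc_seq enc_nat (vertices Gamma))
      (enc_seq
         (enc_pair (enc_pair enc_nat (fun a => enc_nat (enum_rank a))) enc_nat)
         (edges Gamma))).

End Graph.

(* Pairs of words as words over pairs of symbols, None being the padding. *)
Definition padded_symbol (A : finType) : eqType :=
  (option (letter A) * option (letter A))%type.

Definition pad (A : finType) (u v : word A) : seq (padded_symbol A) :=
  zip (map some u ++ nseq (size v - size u) None)
      (map some v ++ nseq (size u - size v) None).

(* The multiplier automata are indexed by the letters and by None, which
   stands for 1. *)
Record automatic_data (A : finType) := AutomaticData {
  acceptor : automaton (letter A);
  multiplier : option (letter A) -> automaton (padded_symbol A)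
}.

Definition automatic_structure (A : finType) (G : groupType)
    (mu : word A -> G) (L : set (word A)) (D : automatic_data A) : Prop :=
  [/\ accepted (acceptor D) = L,
      forall w, L w -> reduced w,
      mu @` L = setT &
      forall a : option (letter A),
        accepted (multiplier D a) =
        [set w | exists u v, [/\ L u, L v,
           mu (u ++ seq_of_opt a) = mu v & w = pad u v]]].

Definition enc_automatic_data (A : finType) (D : automatic_data A) : tree :=
  let enc := enc_option (@enc_letter A) in
  Node (enc_automaton (@enc_letter A) (acceptor D))
    (enc_seq (fun a =>
        Node (enc a) (enc_automaton (enc_pair enc enc) (multiplier D a)))
      (enum {: option (letter A)})).

Section Problems.
Variables (A : finType) (G : groupType) (mu : word A -> G) (L : set (word A)).

Definition stallings_computable : Prop :=
  exists p : prog,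
    partially_solves p (enc_seq (@enc_word A)) (@enc_rooted_graph A)
      (fun hs => all (@reduced A) hs)
      (fun hs => quasi_convex mu L (generated mu hs))
      (fun hs Gamma => stallings_like mu L (generated mu hs) Gamma).

(* The encoding of the input is a parameter, so that the input of the
   algorithm may contain further data, such as an automatic structure. *)
Definition solves_finiteness (p : prog) (enc : seq (word A) -> tree) : Prop :=
  partially_solves p enc enc_bool
    (fun hs => all (@reduced A) hs)
    (fun hs => quasi_convex mu L (generated mu hs))
    (fun hs b => b <-> finite_set (generated mu hs)).

End Problems.

(* Main.v *)
(* Each element having finitely many L-representatives, H is finite if and only
   if L contains finitely many representatives of elements of H; these are the
   words of L which label a loop of a Stallings-like graph, and the finiteness of
   a rational language is decidable.

   All algorithms are unbounded searches for a certificate which can be checked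
   by a terminating program.  In the automatic case the certificate contains a
   finite deterministic automaton, a part of the Schreier graph of H whose
   states x stand for the cosets H x, with a proof for each transition.  It
   accepts every L-representative of an element of H as soon as, for every
   step (x, a, y) of the loops labeled by the generators and all u, v in L with
   u a = v in G, u leads to x if and only if v leads to y; this is an inductive
   invariant of the product of a multiplier automaton with two copies of the
   graph.  If H is quasi-convex, then by the fellow traveller property the
   L-representatives of the elements of H x stay near H for the finitely many
   cosets H x on these loops, so that a large enough ball of the Schreier graph
   is a certificate. *)

Require Import Defs.
From HB Require Import structures.
From mathcomp Require Import all_boot.
From mathcomp Require Import boolp classical_sets functions cardinality.

Set Implicit Arguments.
Unset Strict Implicit.
Unset Printing Implicit Defensive.

(** * Trees: decidable equality and their reading as lists *)

Fixpoint eqtree (s t : tree) : bool :=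
  match s, t with
  | Leaf, Leaf => true
  | Node s1 s2, Node t1 t2 => eqtree s1 t1 && eqtree s2 t2
  | _, _ => false
  end.

Lemma eqtreeP : Equality.axiom eqtree.
Proof.
elim=> [|s1 IH1 s2 IH2] [|t1 t2] /=; try by constructor.
case: (IH1 t1) => [<-|ne] /=; last by constructor=> -[].
by case: (IH2 t2) => [<-|ne]; constructor=> // -[].
Qed.

HB.instance Definition _ := hasDecEq.Build tree eqtreeP.

(* The right spine of a tree makes it a list of trees; the spine ends in [Leaf],
   so that this is a bijection. *)
Fixpoint lst (t : tree) : seq tree := if t is Node a b then a :: lst b else [::].
Definition mk (s : seq tree) : tree := foldr Node Leaf s.

Lemma mkK : cancel mk lst.
Proof. by elim=> //= x s ->. Qed.

Lemma lstK : cancel lst mk.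
Proof. by elim=> //= x _ s ->. Qed.

Lemma enc_seqE T (enc : T -> tree) s : enc_seq enc s = mk (map enc s).
Proof. by rewrite /enc_seq /mk foldr_map. Qed.

Definition tmap (f : tree -> tree) t := mk (map f (lst t)).
Definition tfilter (p : tree -> bool) t := mk (filter p (lst t)).
Definition tcat s t := mk (lst s ++ lst t).
Definition tflatten t := foldl tcat Leaf (lst t).

Lemma lst_tflatten t : lst (tflatten t) = flatten (map lst (lst t)).
Proof.
rewrite /tflatten -[RHS]/(lst Leaf ++ _).
elim: (lst t) Leaf => [|x s IH] a /=; first by rewrite cats0.
by rewrite IH mkK catA.
Qed.

(** * Computable functions on trees *)

Definition computable (f : tree -> tree) := exists p, forall x, eval p x (f x).
Definition computableb (b : tree -> bool) := computable (fun x => enc_bool (b x)).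

Lemma computable_id : computable (fun x => x).
Proof. by exists PId; constructor. Qed.

Lemma computable_leaf : computable (fun=> Leaf).
Proof. by exists PLeaf; constructor. Qed.

Lemma computable_comp f g :
  computable f -> computable g -> computable (fun x => f (g x)).
Proof. by move=> [p pf] [q qg]; exists (PSeq q p) => x; econstructor. Qed.

Lemma computable_hd f : computable f -> computable (fun x => hd (f x)).
Proof. by apply: computable_comp; exists PHd; constructor. Qed.

Lemma computable_tl f : computable f -> computable (fun x => tl (f x)).
Proof. by apply: computable_comp; exists PTl; constructor. Qed.

Lemma computable_node f g :
  computable f -> computable g -> computable (fun x => Node (f x) (g x)).
Proof. by move=> [p pf] [q qg]; exists (PNode p q) => x; econstructor. Qed.

Lemma computable_cst t : computable (fun=> t).
Proof.
elim: t => [|s IHs t IHt]; first exact: computable_leaf.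
exact: computable_node.
Qed.

Lemma computable_ifleaf c f g : computable c -> computable f -> computable g ->
  computable (fun x => if c x == Leaf then f x else g x).
Proof.
move=> [pc ec] [pf ef] [pg eg]; exists (PIf pc pg pf) => x.
move: (ec x); case: (c x) => [|l r] e /=; first exact: EIfF.
exact: EIfT e _.
Qed.

Lemma computable_if b f g : computableb b -> computable f -> computable g ->
  computable (fun x => if b x then f x else g x).
Proof.
move=> cb cf cg; have [p e] := computable_ifleaf cb cg cf.
by exists p => x; move: (e x); case: (b x).
Qed.

Lemma computableb_if b f g : computableb b -> computableb f -> computableb g ->
  computableb (fun x => if b x then f x else g x).
Proof.
move=> cb cf cg; have [p e] := computable_if cb cf cg.
by exists p => x; move: (e x); case: (b x).
Qed.

Lemma computableb_cst (b : bool) : computableb (fun=> b).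
Proof. exact: computable_cst. Qed.

Lemma computableb_and b c :
  computableb b -> computableb c -> computableb (fun x => b x && c x).
Proof.
by move=> cb cc; exact: (computableb_if cb cc (computableb_cst false)).
Qed.

Lemma computableb_neg b : computableb b -> computableb (fun x => ~~ b x).
Proof.
by move=> cb; exact: (computableb_if cb (computableb_cst false) (computableb_cst true)).
Qed.

Lemma computableb_or b c :
  computableb b -> computableb c -> computableb (fun x => b x || c x).
Proof.
by move=> cb cc; exact: (computableb_if cb (computableb_cst true) cc).
Qed.

Lemma computableb_imply b c :
  computableb b -> computableb c -> computableb (fun x => b x ==> c x).
Proof.
by move=> cb cc; exact: (computableb_if cb cc (computableb_cst true)).
Qed.

Lemma computableb_eqb b c :
  computableb b -> computableb c -> computableb (fun x => b x == c x).
Proof.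
move=> cb cc; have [p e] := computableb_if cb cc (computableb_neg cc).
by exists p => x; move: (e x); case: (b x); case: (c x).
Qed.

Lemma computableb_comp b f :
  computableb b -> computable f -> computableb (fun x => b (f x)).
Proof. by move=> cb cf; exact: computable_comp cb cf. Qed.

(** One unfolding of a loop whose test and body compute total functions; used repeatedly, it runs
    loops symbolically. *)
Lemma eval_while c f pc pf x :
  (forall x, eval pc x (c x)) -> (forall x, eval pf x (f x)) ->
  forall z, (if c x is Leaf then z = x else eval (PWhile pc pf) (f x) z) ->
  eval (PWhile pc pf) x z.
Proof.
move=> ec ef z; move: (ec x); case: (c x) => [|l r] e; first by move->; constructor.
by move=> w; apply: EWhileT e (ef x) w.
Qed.

(** The loop behind all list functions: the memory holds the parameter [x], which [F] may consult,
    then the accumulator, then the part of the list still to be read. *)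
Lemma computable_foldl F z s : computable z -> computable s ->
  computable (fun y => F (hd y) (hd (tl y)) (tl (tl y))) ->
  computable (fun x => foldl (F x) (z x) (lst (s x))).
Proof.
move=> cz cs [pF eF].
have [pc ec] : computable (fun y => tl (tl y)).
  by do 2 apply: computable_tl; exact: computable_id.
have [pf ef] : computable (fun y =>
    Node (hd y) (Node (F (hd y) (hd (tl y)) (hd (tl (tl y)))) (tl (tl (tl y))))).
  have ci := computable_id; have ch := computable_hd ci; have ct := computable_tl ci.
  apply: computable_node => //; apply: computable_node; last by do 2 apply: computable_tl.
  have [q eq] : computable (fun y => Node (hd y) (Node (hd (tl y)) (hd (tl (tl y))))).
    apply: computable_node => //; apply: computable_node; apply: computable_hd => //.
    exact: computable_tl.
  by exists (PSeq q pF) => y; apply: (ESeq (eq y)); exact: (eF (Node _ (Node _ _))).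
have [pi ei] := computable_node computable_id (computable_node cz cs).
exists (PSeq pi (PSeq (PWhile pc pf) (PSeq PTl PHd))) => x.
apply: (ESeq (ei x)); apply: (@ESeq _ _ _ (Node x (Node (foldl (F x) (z x) (lst (s x))) Leaf))).
  elim: (s x) (z x) => [|a _ t IH] acc /=; apply: (eval_while ec ef) => //=.
by apply: ESeq; constructor.
Qed.

Lemma computableb_eq f g :
  computable f -> computable g -> computableb (fun x => f x == g x).
Proof.
suff ce : computableb (fun y => hd y == tl y).
  by move=> cf cg; exact: computableb_comp ce (computable_node cf cg).
have ci := computable_id; have cst := computable_cst.
have [pc ec] : computable (fun y => if hd y == Leaf then Leaf else tl y).
  by apply: computable_ifleaf => //; [apply: computable_hd|apply: computable_tl].
(* The memory is a flag followed by a stack of pairs still to be compared. Two leaves are popped,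
   two nodes are replaced by the pairs of their subtrees, and a mismatch erases everything, the flag
   included. *)
pose f' y := let p := hd (tl y) in
  if hd p == Leaf then
    if tl p == Leaf then Node (hd y) (tl (tl y)) else Leaf
  else if tl p == Leaf then Leaf else
    Node (hd y) (Node (Node (hd (hd p)) (hd (tl p)))
                (Node (Node (tl (hd p)) (tl (tl p))) (tl (tl y)))).
have [pf ef] : computable f'.
  rewrite /f'; do ![apply: computable_ifleaf | apply: computable_node
    | apply: computable_hd | apply: computable_tl]; exact: ci || exact: cst.
have [pi ei] : computable (fun x => Node (Node Leaf Leaf) (Node x Leaf)).
  by do ![apply: computable_node | exact: cst].
exists (PSeq pi (PSeq (PWhile pc pf) PHd)) => x.
apply: (ESeq (ei x)).
(* The rest [r] of the stack is arbitrary: the comparison of [a] with [b] either goes on with [r] or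
   stops at [Leaf]. *)
have loop a b r z :
    (if a == b then eval (PWhile pc pf) (Node (Node Leaf Leaf) r) z else z = Leaf) ->
    eval (PWhile pc pf) (Node (Node Leaf Leaf) (Node (Node a b) r)) z.
  elim: a b r => [|a1 IH1 a2 IH2] [|b1 b2] r /= h; apply: (eval_while ec ef) => //=;
    rewrite /f' /=; try by rewrite h; apply: (eval_while ec ef).
  apply: IH1; move: h; rewrite -[_ == _]/((a1 == b1) && (a2 == b2)).
  by case: (a1 == b1) => //= h; apply: IH2.
apply: (@ESeq _ _ _ (if hd x == tl x then Node (Node Leaf Leaf) Leaf else Leaf)).
  case: x => [|a b] /=; first by do 2 apply: (eval_while ec ef) => //=.
  apply: loop; case: eqP => // _; exact: (eval_while ec ef).
by case: eqP => _; constructor.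
Qed.

(* Syntax-directed proofs of computability; [comp_named] is a hook, redefined
   below as more functions are shown to be computable. *)
Ltac comp_named := fail.
Ltac comp_step :=
  cbv beta;
  match goal with
  | |- computable (fun x => x) => exact: computable_id
  | |- computable hd => exact: (computable_hd computable_id)
  | |- computable tl => exact: (computable_tl computable_id)
  | |- computable (fun=> ?t) => exact: (computable_cst t)
  | |- computableb (fun=> ?b) => exact: (computableb_cst b)
  | H : computable ?f |- computable (fun y => ?f (@?e y)) =>
      apply: (@computable_comp f e H)
  | H : computable ?f |- computable ?f => exact: H
  | H : computableb ?f |- computableb (fun y => ?f (@?e y)) =>
      apply: (@computableb_comp f e H)
  | H : computable (fun y => ?f (hd y) (tl y)) |-
      computable (fun y => ?f (@?a y) (@?b y)) =>
      refine (computable_comp (g := fun y => Node (a y) (b y)) H _)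
  | H : computableb (fun y => ?f (hd y) (tl y)) |-
      computableb (fun y => ?f (@?a y) (@?b y)) =>
      refine (computableb_comp (f := fun y => Node (a y) (b y)) H _)
  | |- computable (fun x => hd (@?f x)) => apply: (@computable_hd f)
  | |- computable (fun x => tl (@?f x)) => apply: (@computable_tl f)
  | |- computable (fun x => Node (@?f x) (@?g x)) => apply: (@computable_node f g)
  | |- computable (fun x => enc_bool (@?b x)) => change (computableb b)
  | |- computableb (fun x => @?b x && @?c x) => apply: (@computableb_and b c)
  | |- computableb (fun x => @?b x || @?c x) => apply: (@computableb_or b c)
  | |- computableb (fun x => @?b x ==> @?c x) => apply: (@computableb_imply b c)
  | |- computableb (fun x => ~~ @?b x) => apply: (@computableb_neg b)
  | |- computableb (fun x => @eq_op _ (@?b x) (@?c x)) =>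
      first [apply: (@computableb_eq b c) | apply: (@computableb_eqb b c)]
  | |- _ => comp_named
  | |- computable _ => apply: computable_if
  end.
Ltac comp := repeat comp_step.

(** * List functions: search, reversal, map, filter, concatenation *)

Lemma computableb_has P s : computableb (fun y => P (hd y) (tl y)) ->
  computable s -> computableb (fun x => has (P x) (lst (s x))).
Proof.
move=> cP cs.
pose F x acc e := if acc == Leaf then enc_bool (P x e) else acc.
have [|p ep] := @computable_foldl F (fun=> Leaf) s (computable_cst _) cs.
  apply: (@computable_ifleaf (fun y => hd (tl y))); comp.
exists p => x; move: (ep x); congr eval.
have FT l : foldl (F x) (Node Leaf Leaf) l = Node Leaf Leaf by elim: l.
by elim: (lst (s x)) => //= e l IH; rewrite /F /=; case: (P x e).
Qed.

Lemma computableb_all P s : computableb (fun y => P (hd y) (tl y)) ->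
  computable s -> computableb (fun x => all (P x) (lst (s x))).
Proof.
move=> cP cs; have [p ep] := computableb_neg
  (@computableb_has (fun x e => ~~ P x e) s (computableb_neg cP) cs).
exists p => x; move: (ep x); congr (eval _ _ (enc_bool _)).
by rewrite has_predC negbK.
Qed.

Lemma computableb_mem f s : computable f -> computable s ->
  computableb (fun x => f x \in lst (s x)).
Proof.
move=> cf cs.
have [|p ep] := @computableb_has (fun x e => e == f x) s _ cs; first by comp.
by exists p => x; move: (ep x); rewrite has_pred1.
Qed.

(** A left fold that pushes elements builds its result backwards; reversing the argument first turns
    it into a right fold, which is how the next lemmas use this one. *)
Lemma computable_mkrev s : computable s -> computable (fun x => mk (rev (lst (s x)))).
Proof.
move=> cs; have [||p ep] :=
  @computable_foldl (fun _ a e => Node e a) (fun=> Leaf) s _ cs; try by comp.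
exists p => x; move: (ep x); congr eval; rewrite -[rev _]/(catrev _ (lst Leaf)).
by elim: (lst (s x)) Leaf => [|e l IH] acc /=; rewrite ?lstK // IH.
Qed.

Lemma computable_tmap F s : computable (fun y => F (hd y) (tl y)) ->
  computable s -> computable (fun x => tmap (F x) (s x)).
Proof.
move=> cF /computable_mkrev cs.
have [|||p ep] := @computable_foldl (fun x a e => Node (F x e) a) (fun=> Leaf)
    (fun x => mk (rev (lst (s x)))); try by comp.
exists p => x; move: (ep x); rewrite mkK /tmap; congr eval.
by rewrite foldl_rev /mk foldr_map.
Qed.

Lemma computable_tfilter P s : computableb (fun y => P (hd y) (tl y)) ->
  computable s -> computable (fun x => tfilter (P x) (s x)).
Proof.
move=> cP /computable_mkrev cs.
have [|||p ep] := @computable_foldl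
    (fun x a e => if P x e then Node e a else a) (fun=> Leaf)
    (fun x => mk (rev (lst (s x)))); try by comp.
exists p => x; move: (ep x); rewrite mkK /tfilter; congr eval; rewrite foldl_rev.
by elim: (lst (s x)) => //= e l ->; case: (P x e).
Qed.

Lemma computable_tcat s t :
  computable s -> computable t -> computable (fun x => tcat (s x) (t x)).
Proof.
move=> /computable_mkrev cs ct.
have [|p ep] := @computable_foldl (fun _ a e => Node e a) t _ ct cs; first by comp.
exists p => x; move: (ep x); rewrite mkK /tcat; congr eval.
by rewrite foldl_rev /mk foldr_cat -/(mk (lst _)) lstK.
Qed.

Lemma computable_tflatten s : computable s -> computable (fun x => tflatten (s x)).
Proof.
move=> cs; apply: (@computable_foldl (fun=> tcat) (fun=> Leaf)) => //; first by comp.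
by apply: computable_tcat; comp.
Qed.

Ltac comp_list :=
  match goal with
  | |- computableb (fun x => has (@?b x) (lst (@?s x))) => apply: (@computableb_has b s)
  | |- computableb (fun x => all (@?b x) (lst (@?s x))) => apply: (@computableb_all b s)
  | |- computableb (fun x => @?f x \in lst (@?s x)) => apply: (@computableb_mem f s)
  | |- computable (fun x => tmap (@?f x) (@?s x)) => apply: (@computable_tmap f s)
  | |- computable (fun x => tfilter (@?b x) (@?s x)) => apply: (@computable_tfilter b s)
  | |- computable (fun x => tcat (@?s x) (@?t x)) => apply: (@computable_tcat s t)
  | |- computable (fun x => tflatten (@?s x)) => apply: (@computable_tflatten s)
  | |- computable (fun x => mk (rev (lst (@?s x)))) => apply: (@computable_mkrev s)
  | |- computable (fun x => foldl (@?f x) (@?z x) (lst (@?s x))) =>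
      apply: (@computable_foldl f z s)
  end.
Ltac comp_named ::= comp_list.

(** Turns a total checker into a partial algorithm: all trees are enumerated by increasing height
    until one passes. Several certificates may exist, so nothing but [check x c] is known of the
    output. *)
Lemma unbounded_search (check : tree -> tree -> bool) :
  computableb (fun y => check (hd y) (tl y)) ->
  exists p, forall x,
    ((exists c, check x c) -> exists2 c, check x c & eval p x c) /\
    (halts p x -> exists c, check x c).
Proof.
move=> cc.
(* [next] maps the list of the trees of height less than n to the list of those
   of height at most n. *)
pose next t := Node Leaf (foldl (fun acc a =>
  foldl (fun acc b => Node (Node a b) acc) acc (lst t)) Leaf (lst t)).
have nextP t u : (u \in lst (next t)) =
    (u == Leaf) || (if u is Node a b then (a \in lst t) && (b \in lst t) else false).
  rewrite /= in_cons; congr (_ || _).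
  have inner a s acc : (u \in lst (foldl (fun acc b => Node (Node a b) acc) acc s)) =
      (u \in lst acc) || (if u is Node a' b then (a' == a) && (b \in s) else false).
    elim: s acc => [|b s IH] acc /=; first by case: (u) => *; rewrite ?andbF orbF.
    rewrite IH /= in_cons; case: (u) => [|a' b'] //.
    have -> : (Node a' b' == Node a b) = (a' == a) && (b' == b) by [].
    rewrite in_cons.
    by do ![case: (_ == _) | case: (_ \in _)].
  have outer s acc : (u \in lst (foldl (fun acc a =>
        foldl (fun acc b => Node (Node a b) acc) acc (lst t)) acc s)) =
      (u \in lst acc) || (if u is Node a b then (a \in s) && (b \in lst t) else false).
    elim: s acc => [|a s IH] acc /=; first by case: (u) => *; rewrite ?orbF.
    rewrite IH inner -orbA; congr (_ || _); case: (u) => // a' b.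
    by rewrite in_cons andb_orl.
  by rewrite outer.
have all_trees u : exists n, u \in lst (iter n next Leaf).
  have mono m n s : m <= n -> s \in lst (iter m next Leaf) -> s \in lst (iter n next Leaf).
    elim: m n s => // m IH [//|n] [|a b] le_mn; rewrite !iterS !nextP //=.
    by case/andP=> ia ib; rewrite !(IH n).
  elim: u => [|a [m am] b [n bn]]; first by exists 1.
  exists (maxn m n).+1; rewrite iterS nextP /=.
  by rewrite (mono _ _ _ (leq_maxl _ _) am) (mono _ _ _ (leq_maxr _ _) bn).
pose test y := if has (check (hd y)) (lst (tl y)) then Leaf else Node Leaf Leaf.
have [pc ec] : computable test by rewrite /test; comp.
have [pf ef] : computable (fun y => Node (hd y) (next (tl y))) by rewrite /next; comp.
have [pi ei] : computable (fun x => Node x Leaf) by comp.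
have [po eo] : computable (fun y => hd (tfilter (check (hd y)) (tl y))) by comp.
exists (PSeq pi (PSeq (PWhile pc pf) po)) => x.
pose st n := Node x (iter n next Leaf).
split=> [[c0 c0P]|[z ez]].
- have ex : exists n, has (check x) (lst (iter n next Leaf)).
    by have [n c0n] := all_trees c0; exists n; apply/hasP; exists c0.
  have loop : eval (PWhile pc pf) (st 0) (st (ex_minn ex)).
    case: ex_minnP => n hn min_n.
    suff: forall k m, m + k = n -> eval (PWhile pc pf) (st m) (st n) by apply.
    elim=> [|k IH] m; [rewrite addn0|rewrite addnS] => mk_n;
      apply: (eval_while ec ef); rewrite /test /st /=.
      by rewrite mk_n hn.
    have /negPf-> : ~~ has (check x) (lst (iter m next Leaf)).
      by apply/negP => /min_n; rewrite -mk_n ltnNge leq_addr.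
    by apply: (IH m.+1); rewrite addSn.
  set n := ex_minn ex in loop.
  have hn : has (check x) (lst (iter n next Leaf)) by rewrite /n; case: ex_minnP.
  exists (hd (tfilter (check x) (iter n next Leaf))); last first.
    by apply: (ESeq (ei x)); apply: (ESeq loop); exact: (eo (st n)).
  rewrite /tfilter; move: hn; rewrite has_filter.
  case E : (filter _ _) => [//|c s] _ /=.
  by have := mem_head c s; rewrite -E mem_filter => /andP[].
- have {}[y] : halts (PWhile pc pf) (st 0).
    inversion ez as [| | | | |p1 q1 x1 y z1 eiy epo| | | |]; subst.
    inversion epo as [| | | | |p2 q2 x2 y2 z2 ewh _| | | |]; subst.
    by rewrite (eval_det eiy (ei x)) in ewh; exists y2.
  (* Induction on the evaluation, the state being that of an arbitrary round [n]: the loop is left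
     only through a failed test, that is, at a round which contains a certificate. *)
  suff: forall p s t, eval p s t -> p = PWhile pc pf -> forall n, s = st n ->
      exists c, check x c by move=> h e; apply: (h _ _ _ e).
  move=> p s t; elim=> // {p s t} [c p s l r s' t ecl _ eps IHp _ IH|c p s ecl _] [? ?] n ?; subst.
    by apply: (IH _ n.+1) => //; exact: eval_det eps (ef _).
  have := eval_det ecl (ec _); rewrite /test /=.
  by case: ifP => // /hasP[u _ cu] _; exists u.
Qed.

(** * Automata on words of trees *)

Section TreeAutomata.
Implicit Types (T S M I p q s t u : tree) (w : seq tree).

(** A transition is [Node (Node p l) q], the shape given by [enc_automaton]. Sets of states are
    lists, and [nrun] is the subset simulation of a nondeterministic automaton. *)
Definition nstep T S l := tmap tl
  (tfilter (fun t => (hd (hd t) \in lst S) && (tl (hd t) == l)) T).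
Definition nrun T S u := foldl (nstep T) S (lst u).
Definition accb M u :=
  has (fun q => q \in lst (hd (tl M))) (lst (nrun (tl (tl M)) (hd M) u)).

Fixpoint tpath T p w q : Prop :=
  if w is x :: w' then
    exists2 t, t \in lst T & [/\ hd (hd t) = p, tl (hd t) = x & tpath T (tl t) w' q]
  else p = q.

Lemma tpath_cat T p w1 w2 q :
  tpath T p (w1 ++ w2) q <-> exists2 r, tpath T p w1 r & tpath T r w2 q.
Proof.
elim: w1 p => [|x w1 IH] p /=; first by split=> [|[r ->]] //; exists p.
split=> [[t tT [tp tx /IH[r r1 r2]]]|[r [t tT [tp tx r1]] r2]].
  by exists r => //; exists t.
by exists t => //; split=> //; apply/IH; exists r.
Qed.

Lemma nstepP T S l q : q \in lst (nstep T S l) <->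
  exists2 t, t \in lst T & [/\ hd (hd t) \in lst S, tl (hd t) = l & tl t = q].
Proof.
rewrite /nstep /tmap /tfilter !mkK; split=> [/mapP[t]|[t tT [tS tl_l <-]]].
  by rewrite mem_filter => /andP[/andP[tS /eqP tl_l] tT] ->; exists t.
by apply/mapP; exists t; rewrite // mem_filter tS tl_l eqxx.
Qed.

Lemma nrunP T S u q : q \in lst (nrun T S u) <->
  exists2 p, p \in lst S & tpath T p (lst u) q.
Proof.
rewrite /nrun; elim: (lst u) S => [|x s IH] S /=.
  by split=> [qS|[p pS <-] //]; exists q.
rewrite IH; split=> [[r /nstepP[t tT [tS tx <-]] rq]|[p pS [t tT [tp tx rq]]]].
  by exists (hd (hd t)) => //; exists t.
by exists (tl t) => //; apply/nstepP; exists t; rewrite // tp.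
Qed.

Definition taccepted M w := exists p q,
  [/\ p \in lst (hd M), q \in lst (hd (tl M)) & tpath (tl (tl M)) p w q].

Lemma accbP M u : accb M u <-> taccepted M (lst u).
Proof.
split=> [/hasP[q /nrunP[p pi pq] qf]|[p [q [pi qf pq]]]]; first by exists p, q.
by apply/hasP; exists q => //; apply/nrunP; exists p.
Qed.

Lemma tpath_states T p w q : tpath T p w q -> q = p \/ q \in map tl (lst T).
Proof.
elim: w p => [|x w IH] p /=; first by move->; left.
by case=> t tT [_ _ /IH[->|]]; right => //; apply: map_f.
Qed.

(* An inductive invariant [I] of the automaton [M] running along with a
   deterministic transition function [step]. *)
Definition invb (step : tree -> tree -> tree) (good : tree -> bool) s0 M I :=
  [&& all (fun q => Node q s0 \in lst I) (lst (hd M)),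
      all (fun t => all (fun i => (hd i == hd (hd t)) ==>
        (Node (tl t) (step (tl i) (tl (hd t))) \in lst I)) (lst I)) (lst (tl (tl M))) &
      all (fun i => (hd i \in lst (hd (tl M))) ==> good (tl i)) (lst I)].

Lemma invb_sound step good s0 M I w :
  invb step good s0 M I -> taccepted M w -> good (foldl step s0 w).
Proof.
case/and3P=> /allP Ii /allP It /allP If [p [q [/Ii pI qf pq]]].
suff qI : Node q (foldl step s0 w) \in lst I.
  by move: (If _ qI); rewrite /= qf.
elim: w p s0 pI pq {Ii} => [|x w IH] p s0 pI /=; first by move<-.
case=> t tT [tp tx pq]; apply: IH pq; have /allP/(_ _ pI) := It _ tT.
by rewrite /= tp eqxx tx.
Qed.

(** The set of all reachable pairs is an invariant. It is finite because states of [M] are initial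
    or targets of transitions, and because [step] preserves the finite list [F]. It may be chosen
    classically, since certificates are found by search. *)
Lemma invb_complete (step : tree -> tree -> tree) (good : tree -> bool) s0 M
    (F : seq tree) :
  s0 \in F -> (forall s l, s \in F -> step s l \in F) ->
  (forall w, taccepted M w -> good (foldl step s0 w)) ->
  exists I, invb step good s0 M I.
Proof.
move=> F0 FS FG; pose Q := lst (hd M) ++ map tl (lst (tl (tl M))).
pose reach i := `[< exists w p, [/\ p \in lst (hd M), tpath (tl (tl M)) p w (hd i)
  & foldl step s0 w = tl i] >].
pose I := mk [seq i <- [seq Node q s | q <- Q, s <- F] | reach i].
have FF w s : s \in F -> foldl step s w \in F.
  by elim: w s => //= x w IH s sF; apply: IH; apply: FS.
have memI q s : reach (Node q s) -> Node q s \in lst I.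
  move=> r; rewrite mkK mem_filter r /=; move: r => /asboolP[w [p [pi pq /= <-]]].
  apply/allpairsP; exists (q, foldl step s0 w); split=> //; last exact: FF.
  by rewrite mem_cat; case: (tpath_states pq) => /= ->; rewrite ?pi ?orbT.
exists I; apply/and3P; split; apply/allP.
- by move=> q qi; apply: memI; apply/asboolP; exists [::], q.
- move=> t tT; apply/allP => i; rewrite {1}mkK mem_filter => /andP[/asboolP[w [p [pi pq ws]]] _].
  apply/implyP => /eqP it; apply: memI; apply/asboolP; exists (rcons w (tl (hd t))), p.
  split=> //; last by rewrite foldl_rcons ws.
  by rewrite -cats1; apply/tpath_cat; exists (hd i) => //; exists t.
- move=> i; rewrite mkK mem_filter => /andP[/asboolP[w [p [pi pq ws]]] _].
  by apply/implyP => qf; rewrite -ws; apply: FG; exists p, (hd i).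
Qed.

(* [Leaf] is the failure state; the keys of the list [d] are pairs of a state
   and a letter. *)
Definition dstep d s l :=
  if s == Leaf then Leaf
  else foldl (fun r e => if hd e == Node s l then tl e else r) Leaf (lst d).

Lemma dstep_mem d s l : dstep d s l != Leaf ->
  s != Leaf /\ exists2 e, e \in lst d & hd e = Node s l /\ tl e = dstep d s l.
Proof.
rewrite /dstep; case: (s == Leaf) => // nz; split=> //; move: nz.
set f := fun _ _ => _.
have h r : foldl f r (lst d) = r \/
    exists2 e, e \in lst d & hd e = Node s l /\ tl e = foldl f r (lst d).
  elim: (lst d) r => [|e d' IH] r /=; first by left.
  case: (IH (f r e)) => [->|[e' e'd h]]; last first.
    by right; exists e'; rewrite // inE e'd orbT.
  rewrite /f; case: eqP => [he|_]; last by left.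
  by right; exists e; rewrite ?mem_head.
by case: (h Leaf) => // ->.
Qed.

Lemma dstep_states d s l : dstep d s l \in Leaf :: map tl (lst d).
Proof.
rewrite in_cons; case: (boolP (_ == Leaf)) => //= /dstep_mem[_ [e ed [_ <-]]].
exact: map_f.
Qed.

(** The fold in [dstep] keeps the last entry with the right key, so all entries with this key have
    to agree. *)
Lemma dstep_uniq d s l e : e \in lst d -> s != Leaf -> hd e = Node s l ->
  (forall e', e' \in lst d -> hd e' = Node s l -> tl e' = tl e) ->
  dstep d s l = tl e.
Proof.
move=> ed /negPf snz he u; rewrite /dstep snz.
set f := fun _ _ => _.
have h r (s' : seq tree) : {subset s' <= lst d} ->
    foldl f r s' = if has (fun e => hd e == Node s l) s' then tl e else r.
  elim: s' r => [|e' s' IH] r //= sub; rewrite IH; last first.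
    by move=> x xs; apply: sub; rewrite inE xs orbT.
  rewrite /f; case: eqP => //= he'; rewrite (u e') ?if_same //.
  by apply: sub; rewrite mem_head.
by rewrite h // ifT //; apply/hasP; exists e; rewrite ?he.
Qed.

Lemma foldl_dstep_leaf d w : foldl (dstep d) Leaf w = Leaf.
Proof. by elim: w. Qed.

Lemma foldl_dstep_states d s w : foldl (dstep d) s w \in [:: s, Leaf & map tl (lst d)].
Proof.
elim/last_ind: w => [|w l _]; first by rewrite mem_head.
by rewrite foldl_rcons inE dstep_states orbT.
Qed.

End TreeAutomata.

Lemma computable_nrun T S w : computable T -> computable S -> computable w ->
  computable (fun x => nrun (T x) (S x) (w x)).
Proof. by move=> cT cS cw; rewrite /nrun /nstep; comp. Qed.

Lemma computableb_accb M w : computable M -> computable w ->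
  computableb (fun x => accb (M x) (w x)).
Proof.
move=> cM cw; rewrite /accb.
have c := computable_nrun (computable_tl (computable_tl cM)) (computable_hd cM) cw.
by comp.
Qed.

Lemma computable_dstep d s l : computable d -> computable s -> computable l ->
  computable (fun x => dstep (d x) (s x) (l x)).
Proof. by move=> cd cs cl; rewrite /dstep; comp. Qed.

Lemma computableb_invb (step : tree -> tree -> tree -> tree)
    (good : tree -> tree -> bool) s M I :
  computable (fun y => step (hd y) (hd (tl y)) (tl (tl y))) ->
  computableb (fun y => good (hd y) (tl y)) ->
  computable s -> computable M -> computable I ->
  computableb (fun x => invb (step x) (good x) (s x) (M x) (I x)).
Proof.
move=> cstep cgood cs cM cI; rewrite /invb; comp.
(* Inside the two nested traversals the memory is [Node (Node x t) i]; it is rearranged into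
   parameter, state and letter. *)
refine (computable_comp (g := fun y =>
  Node (hd (hd y)) (Node (tl (tl y)) (tl (hd (tl (hd y)))))) cstep _).
by comp.
Qed.

Ltac comp_named ::=
  first [comp_list | match goal with
  | |- computable (fun x => nrun (@?T x) (@?S x) (@?w x)) =>
      apply: (@computable_nrun T S w)
  | |- computableb (fun x => accb (@?M x) (@?w x)) => apply: (@computableb_accb M w)
  | |- computableb (fun x => invb (@?f x) (@?g x) (@?s x) (@?M x) (@?I x)) =>
      apply: (@computableb_invb f g s M I)
  | |- computable (fun x => dstep (@?d x) (@?s x) (@?l x)) =>
      apply: (@computable_dstep d s l)
  end].

(** * Finiteness of a rational language *)

Definition bounded (T : Type) (X : set (seq T)) := exists n, forall w, X w -> size w <= n.

Section Finiteness.
Implicit Types (M d b c p q s t u : tree) (w : seq tree).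

(** The words of [M] which label a loop at [b] in the deterministic graph [d]. *)
Definition rlang M d b : set (seq tree) :=
  [set w | taccepted M w /\ foldl (dstep d) b w = b].

(* A certificate that [rlang M d b] is finite is a bound on the length of its
   words, read as a countdown, along with an inductive invariant; a certificate
   that it is infinite is a word with a factor which can be pumped. *)
Definition finb M d b c :=
  if hd c == Leaf then
    let ws := hd (tl c) in let p := hd (tl (tl c)) in let s := tl (tl (tl c)) in
    [&& hd ws != Leaf,
        p \in lst (nrun (tl (tl M)) (hd M) (hd (tl ws))),
        p \in lst (nrun (tl (tl M)) (Node p Leaf) (hd ws)),
        has (fun q => q \in lst (hd (tl M)))
          (lst (nrun (tl (tl M)) (Node p Leaf) (tl (tl ws)))),
        foldl (dstep d) b (lst (hd (tl ws))) == s,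
        foldl (dstep d) s (lst (hd ws)) == s &
        foldl (dstep d) s (lst (tl (tl ws))) == b]
  else invb (fun ks l => Node (tl (hd ks)) (dstep d (tl ks) l))
         (fun ks => ~~ ((hd ks == Leaf) && (tl ks == b)))
         (Node (hd (tl c)) b) M (tl (tl c)).

(** In the infinite case [p] and [s] are the states of [M] and [d] at both ends of the pumped factor
    [hd ws], which sits between the prefix [hd (tl ws)] and the suffix [tl (tl ws)]. In the finite
    case the countdown loses one unit per letter. *)
Lemma finb_sound M d b c : finb M d b c -> (hd c != Leaf <-> bounded (rlang M d b)).
Proof.
rewrite /finb; case: eqP => _ /=.
- set ws := hd (tl c); set p := hd (tl (tl c)); set s := tl (tl (tl c)).
  case/and5P=> nz /nrunP[p0 p0i p1] /nrunP[? /[!inE] /eqP-> p2] /hasP[q].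
  case/nrunP=> [? /[!inE] /eqP-> p3] qf /and3P[/eqP d1 /eqP d2 /eqP d3].
  split=> // -[n bd]; exfalso.
  pose w k := lst (hd (tl ws)) ++ flatten (nseq k (lst (hd ws))) ++ lst (tl (tl ws)).
  have: rlang M d b (w n.+1).
    split; last first.
      have pump k : foldl (dstep d) s (flatten (nseq k (lst (hd ws)))) = s.
        by elim: k => //= k IH; rewrite foldl_cat d2.
      by rewrite foldl_cat d1 foldl_cat pump.
    exists p0, q; split=> //; apply/tpath_cat; exists p => //; apply/tpath_cat.
    exists p => //; elim: n.+1 => //= k IH.
    by apply/tpath_cat; exists p.
  move/bd; rewrite leqNgt => /negP; apply; rewrite !size_cat size_flatten.
  rewrite /shape map_nseq sumn_nseq; case: (hd ws) nz => // x t _.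
  by apply/ltn_addl/ltn_addr; rewrite -mulnS leq_pmull.
- move=> I; split=> // _; exists (size (lst (hd (tl c)))) => w [wM wb].
  have := invb_sound I wM; rewrite leqNgt.
  (* Since [tl Leaf] is [Leaf], an exhausted countdown stays exhausted: the invariant excludes all
     longer words of the language at once. *)
  have -> : foldl (fun ks l => Node (tl (hd ks)) (dstep d (tl ks) l)) (Node (hd (tl c)) b) w =
      Node (iter (size w) tl (hd (tl c))) b.
    rewrite -[in RHS]wb; elim/last_ind: (w) => [|w' l IH] //=.
    by rewrite !foldl_rcons IH size_rcons.
  apply: contra => lt_w; rewrite eqxx andbT.
  elim: (size w) (hd (tl c)) lt_w => // n IH [|x t] /= => [_|].
    by elim: n {IH} => //= n /eqP->.
  by rewrite -iterS iterSr; apply: IH.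
Qed.

(** Names the state at each position of a path, so that the pigeonhole principle can be applied to
    positions. *)
Lemma tpath_trace T p w q : tpath T p w q -> exists f : nat -> tree,
  [/\ f 0 = p, f (size w) = q & forall i j, i <= j <= size w ->
      tpath T (f i) (take (j - i) (drop i w)) (f j)].
Proof.
elim: w p => [|x w IH] p /=.
  by move=> <-; exists (fun=> p); split=> // i j _; rewrite drop_oversize ?take_oversize.
case=> t tT [tp tx /IH[f [f0 fw fP]]].
exists (fun i => if i is i'.+1 then f i' else p).
split=> // -[|i] [|j] //=; last by rewrite subSS; apply: fP.
by move=> jw; exists t => //; split=> //; have := fP 0 j jw; rewrite drop0 subn0 f0.
Qed.

(** If [n] bounds the lengths, a countdown from [n.+1] is never exhausted by a word of the language.
    Otherwise some word is longer than the number of states of the product of [M] and [d], and a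
    repeated state delimits a factor to pump. *)
Lemma finb_complete M d b : exists c, finb M d b c.
Proof.
case: (pselect (bounded (rlang M d b))) => [[n bd]|unbd].
- have [K KP] : exists K : seq nat, forall k, (k \in K) = (k < n.+2).
    by exists (iota 0 n.+2) => k; rewrite mem_iota.
  have [||w wM|I iI] := @invb_complete (fun ks l => Node (tl (hd ks)) (dstep d (tl ks) l))
      (fun ks => ~~ ((hd ks == Leaf) && (tl ks == b))) (Node (enc_nat n.+1) b) M
      [seq Node (enc_nat k) s | k <- K, s <- [:: b, Leaf & map tl (lst d)]].
  + by apply/allpairsP; exists (n.+1, b); rewrite /= mem_head KP leqnn.
  + move=> s l /allpairsP[[k s'] [kK _ ->]]; apply/allpairsP.
    exists (k.-1, dstep d s' l); split=> /=; last by case: (k).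
      by move: kK; rewrite !KP; apply: leq_ltn_trans; exact: leq_pred.
    by rewrite inE dstep_states orbT.
  + have -> : foldl (fun ks l => Node (tl (hd ks)) (dstep d (tl ks) l))
        (Node (enc_nat n.+1) b) w = Node (enc_nat (n.+1 - size w)) (foldl (dstep d) b w).
      elim/last_ind: w {wM} => [|w' l IH] //=.
      by rewrite !foldl_rcons IH size_rcons /= subnS; case: (_ - _).
    apply/negP => /andP[/= /eqP kl /eqP wb]; have /bd le_wn : rlang M d b w by [].
    by move: kl; rewrite subSn.
  by exists (Node (Node Leaf Leaf) (Node (enc_nat n.+1) I)).
- pose U := [seq Node q s | q <- lst (hd M) ++ map tl (lst (tl (tl M))),
      s <- [:: b, Leaf & map tl (lst d)]].
  have [w [[[p [q [pi qf /tpath_trace[f [f0 fw fP]]]]] wb] gt_w]] :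
      exists w, rlang M d b w /\ size U < size w.
    apply: contrapT => no; apply: unbd; exists (size U) => w Lw.
    by rewrite leqNgt; apply/negP => lt; apply: no; exists w.
  pose g i := Node (f i) (foldl (dstep d) b (take i w)).
  pose s := [seq g i | i <- iota 0 (size w)].
  have sub : {subset s <= U}.
    move=> _ /mapP[i + ->]; rewrite mem_iota add0n => /= iw; apply: allpairs_f.
      have := fP 0 i; rewrite leq0n (ltnW iw) f0 => /(_ isT) /tpath_states.
      by rewrite mem_cat => -[->|->]; rewrite ?pi ?orbT.
    exact: foldl_dstep_states.
  have sz : size s = size w by rewrite size_map size_iota.
  (* The states at the [size w] first positions all lie in [U], which is shorter. *)
  have /(uniqPn Leaf)[i [j [ij jw]]] : ~~ uniq s.
    by apply/negP => /uniq_leq_size /(_ sub); rewrite sz leqNgt gt_w.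
  rewrite sz in jw; have iw := ltn_trans ij jw.
  rewrite !(nth_map 0) ?size_iota // !nth_iota // !add0n => -[fij dij].
  pose ws := Node (mk (take (j - i) (drop i w))) (Node (mk (take i w)) (mk (drop j w))).
  exists (Node Leaf (Node ws (Node (f i) (foldl (dstep d) b (take i w))))).
  have le_ij := ltnW ij.
  rewrite /finb /= !mkK; apply/and5P; split.
  + rewrite -[Leaf]/(mk [::]) (can_eq mkK) -size_eq0 size_takel ?subn_eq0 -?ltnNge //.
    by rewrite size_drop leq_sub2r // ltnW.
  + apply/nrunP; exists p => //; rewrite mkK.
    by have := fP 0 i; rewrite drop0 subn0 f0; apply; rewrite leq0n ltnW.
  + apply/nrunP; exists (f i); rewrite ?mem_head // mkK {2}fij.
    by apply: fP; rewrite le_ij ltnW.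
  + apply/hasP; exists q => //; apply/nrunP; exists (f i); rewrite ?mem_head // mkK fij.
    rewrite -[drop j w]take_size size_drop -fw; apply: fP.
    by rewrite (ltnW jw) leqnn.
  + have tj : take j w = take i w ++ take (j - i) (drop i w).
      by rewrite -takeD subnKC.
    rewrite eqxx -!foldl_cat -tj -dij eqxx /=.
    by rewrite foldl_cat dij -foldl_cat cat_take_drop wb.
Qed.

End Finiteness.

Lemma computableb_finb M d b c : computable M -> computable d -> computable b ->
  computable c -> computableb (fun x => finb (M x) (d x) (b x) (c x)).
Proof.
move=> cM cd cb cc; rewrite /finb; apply: computableb_if.
- by comp.
- by rewrite /=; comp.
- by comp.
Qed.

(** * Injectivity of the encodings and encoded automata *)

Lemma enc_nat_inj : injective enc_nat.
Proof. by elim=> [|m IH] [|n] //= [/IH ->]. Qed.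

Lemma enc_bool_inj : injective enc_bool.
Proof. by do 2 case. Qed.

Lemma enc_pair_inj S T (encS : S -> tree) (encT : T -> tree) :
  injective encS -> injective encT -> injective (enc_pair encS encT).
Proof. by move=> iS iT [x y] [x' y'] [/iS /= -> /iT /= ->]. Qed.

Lemma enc_option_inj T (enc : T -> tree) : injective enc -> injective (enc_option enc).
Proof. by move=> i [x|] [y|] //= [/i ->]. Qed.

Lemma enc_letter_inj (A : finType) : injective (@enc_letter A).
Proof.
apply: enc_pair_inj; last exact: enc_bool_inj.
by move=> a b /enc_nat_inj /ord_inj /enum_rank_inj.
Qed.

Lemma lst_enc_seq T (enc : T -> tree) s : lst (enc_seq enc s) = map enc s.
Proof. by rewrite enc_seqE mkK. Qed.

Section EncodedAutomaton.
Variables (S : eqType) (enc : S -> tree).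
Implicit Types (M : automaton S) (ts : seq (nat * S * nat)).

Let enc_trans := enc_pair (enc_pair enc_nat enc) enc_nat.

Lemma tpath_enc ts p w q :
  reads (fun r x s => (r, x, s) \in ts) p w q ->
  tpath (enc_seq enc_trans ts) (enc_nat p) (map enc w) (enc_nat q).
Proof.
elim: w p => [|x w IH] p /=; first by move->.
case=> r t /IH rq; exists (enc_trans (p, x, r)) => //.
by rewrite lst_enc_seq map_f.
Qed.

Lemma tpath_dec ts p u q' : tpath (enc_seq enc_trans ts) (enc_nat p) u q' ->
  exists w q, [/\ u = map enc w, q' = enc_nat q &
    reads (fun r x s => (r, x, s) \in ts) p w q].
Proof.
elim: u p => [|x u IH] p /=; first by move<-; exists [::], p.
case=> t + [tp tx tq]; rewrite lst_enc_seq => /mapP[[[p' y] r] tin tE].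
move: tp tx tq; rewrite tE /= => /enc_nat_inj <- <-.
by case/IH=> w [q [-> -> rq]]; exists (y :: w), q; split=> //; exists r.
Qed.

(** Nothing outside the image of the encoding is accepted, since transitions carry encoded letters
    and states; injectivity of [enc_nat] glues consecutive transitions. *)
Lemma taccepted_enc M u :
  taccepted (enc_automaton enc M) u <-> exists2 w, u = map enc w & accepted M w.
Proof.
split=> [[p' [q' [/= + + pq]]]|[w -> [p [q [pi qf pq]]]]].
- rewrite !lst_enc_seq => /mapP[p pi pE] /mapP[q qf qE].
  move: pq; rewrite pE => /tpath_dec[w [r [-> rE rw]]]; exists w => //.
  by exists p, q; split=> //; move: rE; rewrite qE => /enc_nat_inj ->.
- exists (enc_nat p), (enc_nat q); rewrite /= !lst_enc_seq !map_f //.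
  by split=> //; apply: tpath_enc.
Qed.

End EncodedAutomaton.

(** * Rational structures *)

Section GraphAutomaton.
Variable A : finType.
Implicit Types Gamma : rooted_graph A.

(** Each edge gives a forward transition for its letter and a backward one for the inverse letter.
    The tag [Node Leaf] keeps the vertex 0, encoded as [Leaf], apart from the failure state. *)
Definition graph_delta (g : tree) : tree :=
  tcat (tmap (fun e => Node (Node (Node Leaf (hd (hd e))) (Node (tl (hd e)) Leaf))
                            (Node Leaf (tl e))) (tl (tl g)))
       (tmap (fun e => Node (Node (Node Leaf (tl e)) (Node (tl (hd e)) (Node Leaf Leaf)))
                            (Node Leaf (hd (hd e)))) (tl (tl g))).

Definition graph_base (g : tree) : tree := Node Leaf (hd g).

Let adj Gamma x (l : letter A) y :=
  if l.2 then (y, l.1, x) \in edges Gamma else (x, l.1, y) \in edges Gamma.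

Lemma graph_deltaP Gamma e : e \in lst (graph_delta (enc_rooted_graph Gamma)) <->
  exists x l y, adj Gamma x l y /\
    e = Node (Node (Node Leaf (enc_nat x)) (enc_letter l)) (Node Leaf (enc_nat y)).
Proof.
rewrite mkK !mkK /= mem_cat lst_enc_seq -!map_comp; split.
- case/orP=> /mapP[[[x a] y] xay ->].
    by exists x, (a, false), y.
  by exists y, (a, true), x.
- case=> x [[a b] [y [xay ->]]]; apply/orP; case: b xay => xay; [right|left].
    by apply/mapP; exists (y, a, x).
  by apply/mapP; exists (x, a, y).
Qed.

(** Folding at sources handles the positive letters, folding at targets the inverse ones. *)
Lemma folded_adj Gamma x l y y' :
  folded Gamma -> adj Gamma x l y -> adj Gamma x l y' -> y = y'.
Proof.
rewrite /adj => fG; case: (l.2) => e e'; apply: contrapT => ne;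
  apply: (fG _ _ e e') => //; try by move=> [].
- by right.
- by left.
Qed.

Lemma graph_dstep Gamma x l s : folded Gamma ->
  let r := dstep (graph_delta (enc_rooted_graph Gamma)) (Node Leaf (enc_nat x))
             (enc_letter l) in
  r = s /\ s != Leaf <-> exists2 y, adj Gamma x l y & s = Node Leaf (enc_nat y).
Proof.
move=> fG /=; split=> [[<- /dstep_mem[_ [e /graph_deltaP[x' [l' [y [xly eE]]]] [he <-]]]]|].
  rewrite eE in he *; have /enc_nat_inj <- := congr1 (fun t => tl (hd t)) he.
  by have /enc_letter_inj <- := congr1 tl he; exists y.
case=> y xly ->; split=> //.
rewrite (@dstep_uniq _ _ _ (Node (Node (Node Leaf (enc_nat x)) (enc_letter l))
  (Node Leaf (enc_nat y)))) //.
  by apply/graph_deltaP; exists x, l, y.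
move=> _ /graph_deltaP[x' [l' [y' [+ ->]]]] /= he.
have /enc_nat_inj -> := congr1 (fun t => tl (hd t)) he.
by have /enc_letter_inj -> := congr1 tl he; move=> /(folded_adj fG xly) ->.
Qed.

(** A folded graph is a partial deterministic automaton over both kinds of letters, and failure is
    absorbing. *)
Lemma labels_pathP Gamma x w y : folded Gamma ->
  labels_path Gamma x w y <->
  foldl (dstep (graph_delta (enc_rooted_graph Gamma))) (Node Leaf (enc_nat x))
    (map (@enc_letter A) w) = Node Leaf (enc_nat y).
Proof.
move=> fG; elim: w x => [|l w IH] x /=.
  by split=> [->|[/enc_nat_inj]].
split=> [[z xlz /IH <-]|].
  have [_ h] := graph_dstep x l (Node Leaf (enc_nat z)) fG.
  by rewrite (proj1 (h (ex_intro2 _ _ z xlz erefl))).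
set s := dstep _ _ _ => run.
have nz : s != Leaf by apply/eqP => E; move: run; rewrite E foldl_dstep_leaf.
have [/(_ (conj erefl nz))[z xlz E] _] := graph_dstep x l s fG.
by exists z => //; apply/IH; rewrite -E.
Qed.

End GraphAutomaton.

Local Open Scope classical_set_scope.

(** * Finite sets of words and the finiteness algorithm for rational structures *)

Definition words_upto (A : finType) n : seq (word A) :=
  flatten [seq [seq val t | t <- enum {: k.-tuple (letter A)}] | k <- iota 0 n.+1].

Lemma mem_words_upto (A : finType) n (w : word A) : (w \in words_upto A n) = (size w <= n).
Proof.
apply/flatten_mapP/idP => [[k + /mapP[t _ ->]]|wn].
  by rewrite mem_iota ltnS size_tuple.
exists (size w); first by rewrite mem_iota ltnS.
by apply/mapP; exists (in_tuple w); rewrite ?mem_enum.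
Qed.

Lemma bounded_finite_set (A : finType) (X : set (word A)) :
  bounded X <-> finite_set X.
Proof.
split=> [[n bd]|/finite_seqP[s ->]].
- apply: (@sub_finite_set _ _ [set` words_upto A n]); last exact: finite_seq.
  by move=> w Xw /=; rewrite mem_words_upto; exact: bd.
- exists (\max_(w <- s) size w) => w ws; exact: leq_bigmax_seq.
Qed.

(** The representatives map onto [H]; conversely they form the union, over [H], of finite fibres. *)
Lemma bounded_representatives (A : finType) (G : groupType) (mu : word A -> G)
    (L : set (word A)) (H : set G) :
  mu @` L = setT -> finitely_many_representatives mu L ->
  (bounded [set w | L w /\ H (mu w)] <-> finite_set H).
Proof.
move=> muL fr; rewrite bounded_finite_set; split=> [fX|fH].
- apply: sub_finite_set (finite_image mu fX) => g Hg.
  have : (mu @` L) g by rewrite muL.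
  by case=> w Lw wg; exists w => //; rewrite /= wg.
- have := bigcup_finite fH (fun g _ => fr g).
  by apply: sub_finite_set => w [Lw Hw]; exists (mu w).
Qed.

Lemma bounded_enc (A : finType) (L : set (word A)) (M : automaton (letter A))
    (K : set (word A)) d b :
  accepted M = L ->
  (forall w, L w -> (K w <-> foldl (dstep d) b (map (@enc_letter A) w) = b)) ->
  (bounded (rlang (enc_automaton (@enc_letter A) M) d b) <->
   bounded [set w | L w /\ K w]).
Proof.
move=> ML Kd; have acc := @taccepted_enc (letter A) (@enc_letter A) M.
split=> -[n bd]; exists n.
- move=> w [Lw /(Kd _ Lw) Kw]; have := bd (map (@enc_letter A) w).
  rewrite size_map; apply; split=> //; apply/acc.
  by exists w; rewrite ?ML.
- move=> _ [/acc[w -> +] wb].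
  by rewrite ML size_map => Lw; apply: bd; split=> //; apply/Kd.
Qed.

(** The program computes a Stallings-like graph, then searches for a certificate that the language
    of its loops in [L] is finite or infinite. The second stage always stops, so the whole stops
    exactly when the first stage does. *)
Lemma finiteness_rational (A : finType) (G : groupType) (mu : word A -> G)
    (L : set (word A)) :
  rational_structure mu L -> stallings_computable mu L ->
  finitely_many_representatives mu L ->
  exists p : prog, solves_finiteness mu L p (enc_seq (@enc_word A)).
Proof.
move=> [[M ML] _ muL] [ps psP] fr.
(* The automaton of [L] is a constant written into the program. *)
pose Mt := enc_automaton (@enc_letter A) M.
have [|pf pfP] := @unbounded_search (fun g c => finb Mt (graph_delta g) (graph_base g) c).
  by apply: computableb_finb; rewrite /graph_delta /graph_base; comp.
have [po poP] : computable (fun c => enc_bool (hd c != Leaf)) by comp.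
exists (PSeq ps (PSeq pf po)) => hs vhs; have [qcP nqcP] := psP hs vhs.
split=> [/qcP[Gamma [rG loopsH Lloops] ePs]|/nqcP nh [y e]]; last first.
  by apply: nh; inversion e as [| | | | |p q x y' z e1 e2| | | |]; subst; exists y'.
have [fwd _] := pfP (enc_rooted_graph Gamma).
have [c cP ec] := fwd (finb_complete _ _ _).
exists (hd c != Leaf); last by apply: (ESeq ePs); apply: (ESeq ec); exact: poP.
rewrite (finb_sound cP) (@bounded_enc _ L M (fun w => generated mu hs (mu w))) //.
  exact: bounded_representatives.
move=> w Lw; have fG : folded Gamma by case: rG.
rewrite -[graph_base _]/(Node Leaf (enc_nat (base Gamma))) -labels_pathP //.
by split=> [|/loopsH //]; exact: Lloops.
Qed.

(** * Certificates for automatic structures *)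

(** Padding is encoded as [Leaf] and removed by the filter; for a genuine letter [tl] strips the tag
    of [Some]. *)
Definition unpad1 z := tmap (fun p => tl (hd p)) (tfilter (fun p => hd p != Leaf) z).
Definition unpad2 z := tmap (fun p => tl (tl p)) (tfilter (fun p => tl p != Leaf) z).

Section Padding.
Variable A : finType.
Implicit Types (u v w : word A) (z : seq (padded_symbol A)).

Definition enc_padded : padded_symbol A -> tree :=
  enc_pair (enc_option (@enc_letter A)) (enc_option (@enc_letter A)).

Lemma size_pad_components u v :
  size (map some u ++ nseq (size v - size u) None) =
  size (map some v ++ nseq (size u - size v) None).
Proof. by rewrite !size_cat !size_map !size_nseq -!maxnE maxnC. Qed.

Lemma pmap_take_padding T (u : seq T) k i :
  pmap id (take i (map some u ++ nseq k None)) = take i u.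
Proof.
elim: u i => [|x u IH] i /=; last by case: i => //= i; rewrite IH.
by elim: k i => [|k IH] [|i] //=.
Qed.

(** Stated for prefixes because the fellow traveller argument cuts a padded pair at an arbitrary
    position. *)
Lemma take_pad1 u v i : pmap fst (take i (pad u v)) = take i u.
Proof.
rewrite -(pmap_take_padding u (size v - size u)).
have <- := @unzip1_zip _ _ (map some u ++ nseq (size v - size u) None)
  (map some v ++ nseq (size u - size v) None) (eq_leq (size_pad_components u v)).
by rewrite /unzip1 -map_take -/(pad u v); elim: (take _ _) => //= p s ->.
Qed.

Lemma take_pad2 u v i : pmap snd (take i (pad u v)) = take i v.
Proof.
rewrite -(pmap_take_padding v (size u - size v)).
have <- := @unzip2_zip _ _ (map some u ++ nseq (size v - size u) None)
  (map some v ++ nseq (size u - size v) None) (eq_leq (esym (size_pad_components u v))).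
by rewrite /unzip2 -map_take -/(pad u v); elim: (take _ _) => //= p s ->.
Qed.

Lemma pad1 u v : pmap fst (pad u v) = u.
Proof.
have := take_pad1 u v (maxn (size u) (size (pad u v))).
by rewrite !take_oversize ?leq_max ?leqnn ?orbT.
Qed.

Lemma pad2 u v : pmap snd (pad u v) = v.
Proof.
have := take_pad2 u v (maxn (size v) (size (pad u v))).
by rewrite !take_oversize ?leq_max ?leqnn ?orbT.
Qed.

Lemma unpad1_enc u v t : lst t = map enc_padded (pad u v) -> unpad1 t = enc_word u.
Proof.
rewrite /unpad1 /tmap /tfilter mkK /enc_word enc_seqE => ->; congr mk.
by rewrite -[in RHS](pad1 u v); elim: (pad u v) => //= -[[x|] y] s /= ->.
Qed.

Lemma unpad2_enc u v t : lst t = map enc_padded (pad u v) -> unpad2 t = enc_word v.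
Proof.
rewrite /unpad2 /tmap /tfilter mkK /enc_word enc_seqE => ->; congr mk.
by rewrite -[in RHS](pad2 u v); elim: (pad u v) => //= -[x [y|]] s /= ->.
Qed.

(** Padding leaves the state unchanged, so that each component of [pstep2] runs on its own word. *)
Definition pstep d s o := if o == Leaf then s else dstep d s (tl o).

Definition pstep2 d (ss p : tree) :=
  Node (pstep d (hd ss) (hd p)) (pstep d (tl ss) (tl p)).

Lemma foldl_pstep2 d s s' z : foldl (pstep2 d) (Node s s') (map enc_padded z) =
  Node (foldl (dstep d) s (map (@enc_letter A) (pmap fst z)))
       (foldl (dstep d) s' (map (@enc_letter A) (pmap snd z))).
Proof.
by elim: z s s' => //= -[[x|] [y|]] z IH s s'; rewrite /pstep2 /pstep /= IH.
Qed.

End Padding.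

Section Check.
Implicit Types (D Z T d e c u v w I : tree).

Definition mult_at D a (P : tree -> bool) :=
  all (fun m => (hd m == a) ==> P (tl m)) (lst (tl D)).

(* A list [Z] of pairs (letter, padded pair of words) describes a finite set of
   edges between L-words lying over the Cayley graph. *)
Definition cayley_ok D Z := all (fun e =>
  has (fun m => (hd m == Node Leaf (hd e)) && accb (tl m) (tl e)) (lst (tl D))) (lst Z).
Definition cayley Z :=
  tmap (fun e => Node (Node (unpad1 (tl e)) (hd e)) (unpad2 (tl e))) Z.
Definition reach T u w v := v \in lst (nrun T (Node u Leaf) w).

Definition tinv w := mk (rev (lst (tmap
  (fun l => Node (hd l) (if tl l == Leaf then Node Leaf Leaf else Leaf)) w))).

(* A state is [Node Leaf x] where x is a word, which stands for the coset H x. *)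
Definition start := Node Leaf Leaf.

(* [e] consists of a transition [(x, l, y)] and of a list [c] of generators and
   inverses of generators.  That x l = c y in the group, whence H x l = H y, is
   checked by following x l and c y in the Cayley graph, both from [u] to [v]. *)
Definition edge_ok hs T e :=
  let x := tl (hd (hd (hd e))) in let l := tl (hd (hd e)) in
  let y := tl (tl (hd e)) in
  let c := hd (tl e) in let u := hd (tl (tl e)) in let v := tl (tl (tl e)) in
  [&& all (fun g => has (fun h => (g == h) || (g == tinv h)) (lst hs)) (lst c),
      reach T u (tcat x (Node l Leaf)) v & reach T u (tcat (tflatten c) y) v].

(* [M] accepts only pairs of words of which the first one leads to [y] if and
   only if the second one leads to [y']. *)
Definition multb d y y' I M :=
  invb (pstep2 d) (fun ss => (hd ss == y) == (tl ss == y')) (Node start start) M I.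

(** The head of [e] is a transition [Node (Node y l) y'], its tail an invariant for the multiplier
    automaton of [l]. *)
Definition core_ok D d e :=
  mult_at D (Node Leaf (tl (hd (hd e)))) (multb d (hd (hd (hd e))) (tl (hd e)) (tl e)).

(** [Z] holds edges of the Cayley graph, [E] the transitions with their proofs, [K] transitions
    supporting the loops labeled by generators, [I0] an invariant for the multiplier of 1, and [f] a
    certificate of finiteness or infiniteness. The path labeled [u0] from [u0] to itself forces [u0]
    to be 1 in the group. *)
Definition check_data D hs Z u0 E K I0 f :=
  let d := tmap hd E in
  [&& cayley_ok D Z, accb (hd D) u0, reach (cayley Z) u0 u0 u0,
      all (edge_ok hs (cayley Z)) (lst E), all (core_ok D d) (lst K),
      mult_at D Leaf (multb d start start I0),
      all (fun h => reach (tmap hd K) start h start) (lst hs),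
      foldl (dstep d) start (lst u0) == start & finb (hd D) d start f].

Definition check x c :=
  check_data (hd x) (tl x) (hd c) (hd (tl c)) (hd (tl (tl c))) (hd (tl (tl (tl c))))
    (hd (tl (tl (tl (tl c))))) (tl (tl (tl (tl (tl c))))).

Lemma computableb_multb (d y y' I M : tree -> tree) :
  computable d -> computable y -> computable y' ->
  computable I -> computable M ->
  computableb (fun x => multb (d x) (y x) (y' x) (I x) (M x)).
Proof.
move=> cd cy cy' cI cM; rewrite /multb.
apply: (@computableb_invb (fun x => pstep2 (d x))); rewrite ?/pstep2 ?/pstep; try by comp.
Qed.

Lemma computableb_check : computableb (fun y => check (hd y) (tl y)).
Proof.
rewrite /check /check_data.
do ![apply: computableb_and]; try by comp.
- by rewrite /cayley_ok; comp.
- by rewrite /reach /cayley /unpad1 /unpad2; comp.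
- by rewrite /edge_ok /reach /cayley /unpad1 /unpad2 /tinv /=; comp.
- by rewrite /core_ok /mult_at; comp; apply: computableb_multb; comp.
- by rewrite /mult_at; comp; apply: computableb_multb; comp.
- by rewrite /reach; comp.
- by apply: computableb_finb; rewrite /start; comp.
Qed.

End Check.

Definition invw (A : finType) (w : word A) : word A := rev (map (@inv_letter A) w).

Lemma enc_word_inj (A : finType) : injective (@enc_word A).
Proof.
move=> u v; rewrite /enc_word !enc_seqE => /(can_inj mkK).
exact: inj_map (@enc_letter_inj A) _ _.
Qed.

Lemma tinv_enc (A : finType) (w : word A) : tinv (enc_word w) = enc_word (invw w).
Proof.
rewrite /tinv /tmap mkK /enc_word lst_enc_seq enc_seqE /invw map_rev -!map_comp.
by congr (mk (rev _)); apply: eq_map => -[a []].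
Qed.

Lemma reachP T u w v : reach T u w v <-> tpath T u (lst w) v.
Proof.
rewrite /reach nrunP; split=> [[p /=]|uv]; first by rewrite inE => /eqP->.
by exists u; rewrite ?mem_head.
Qed.

Lemma enc_multipliers (A : finType) (D : automatic_data A) m :
  m \in lst (tl (enc_automatic_data D)) <-> exists a,
    m = Node (enc_option (@enc_letter A) a)
             (enc_automaton (@enc_padded A) (multiplier D a)).
Proof.
rewrite /= lst_enc_seq; split=> [/mapP[a _ ->]|[a ->]]; first by exists a.
by apply/mapP; exists a; rewrite ?mem_enum.
Qed.

Lemma mult_atP (A : finType) (D : automatic_data A) a P :
  mult_at (enc_automatic_data D) (enc_option (@enc_letter A) a) P <->
  P (enc_automaton (@enc_padded A) (multiplier D a)).
Proof.
split=> [/allP h|Pa].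
  have /h : Node (enc_option (@enc_letter A) a)
      (enc_automaton (@enc_padded A) (multiplier D a)) \in lst (tl (enc_automatic_data D)).
    by apply/enc_multipliers; exists a.
  by rewrite /= eqxx.
apply/allP => m /enc_multipliers[b ->]; apply/implyP => /eqP.
by move/(enc_option_inj (@enc_letter_inj A)) ->.
Qed.

(** * Soundness of the certificates *)

Section Generated.
Variables (A : finType) (G : groupType) (mu : word A -> G).
Hypothesis muP : marking mu.
Implicit Types (u v w : word A) (hs : seq (word A)) (g : G).

Lemma mu_nil : mu [::] = 1%g. Proof. by case: muP. Qed.
Lemma mu_cat u v : mu (u ++ v) = (mu u * mu v)%g. Proof. by case: muP. Qed.
Lemma mu_cons l w : mu (l :: w) = (mu [:: l] * mu w)%g.
Proof. by rewrite -mu_cat. Qed.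
Lemma mu_rcons w l : mu (rcons w l) = (mu w * mu [:: l])%g.
Proof. by rewrite -mu_cat cats1. Qed.

Lemma mu_invw w : mu (invw w) = ((mu w)^-1)%g.
Proof.
case: muP => _ _ muV _; elim: w => [|l w IH]; first by rewrite mu_nil invg1.
by rewrite /invw map_cons rev_cons mu_rcons -/(invw w) IH muV -invgM -mu_cons.
Qed.

Lemma generated_subgroup hs : subgroup (generated mu hs).
Proof.
split=> [K [[]//]|g h Hg Hh K KP|g Hg K KP].
- by case: (KP) => -[_ KM _] _; apply: KM; [apply: Hg|apply: Hh].
- by case: (KP) => -[_ _ KV] _; apply: KV; apply: Hg.
Qed.

(** Equality of the right cosets H g and H h is written as membership of g h^-1 in H. This lemma and
    the next two give symmetry, transitivity and compatibility with right multiplication. *)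
Lemma generatedV hs g h : generated mu hs (g * h^-1)%g -> generated mu hs (h * g^-1)%g.
Proof.
by have [_ _ HV] := generated_subgroup hs; move/HV; rewrite invgF.
Qed.

Lemma generatedM hs f g h : generated mu hs (f * g^-1)%g ->
  generated mu hs (g * h^-1)%g -> generated mu hs (f * h^-1)%g.
Proof.
have [_ HM _] := generated_subgroup hs.
by move=> fg gh; have := HM _ _ fg gh; rewrite mulgA mulgVK.
Qed.

Lemma generatedMr hs f g h : generated mu hs (f * g^-1)%g ->
  generated mu hs (f * h * (g * h)^-1)%g.
Proof. by rewrite mulgKA. Qed.

Lemma generated_gen hs h : h \in hs -> generated mu hs (mu h).
Proof. by move=> hhs K [_ sub]; apply: sub; exists h. Qed.

Definition gen_list hs (c : seq (word A)) :=
  forall w, w \in c -> exists2 h, h \in hs & w = h \/ w = invw h.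

Lemma gen_list_generated hs c : gen_list hs c -> generated mu hs (mu (flatten c)).
Proof.
have [H1 HM HV] := generated_subgroup hs.
elim: c => [|w c IH] cP; first by rewrite mu_nil.
rewrite mu_cat; apply: HM; last by apply: IH => v vc; apply: cP; rewrite inE vc orbT.
have [h /generated_gen hhs [->//|->]] := cP w (mem_head _ _).
by rewrite mu_invw; apply: HV.
Qed.

(** The products of generators and their inverses form a subgroup containing the generators, and the
    generated subgroup is the smallest one. *)
Lemma generated_gen_list hs g : generated mu hs g ->
  exists2 c, gen_list hs c & mu (flatten c) = g.
Proof.
move=> Hg; apply: (Hg [set g | exists2 c, gen_list hs c & mu (flatten c) = g]).
split; last first.
  move=> _ [h hhs <-]; exists [:: h]; last by rewrite /= cats0.
  by move=> w /[!inE] /eqP->; exists h; [|left].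
split.
- by exists [::] => //; rewrite mu_nil.
- move=> _ _ [c cP <-] [c' cP' <-]; exists (c ++ c'); last by rewrite flatten_cat mu_cat.
  by move=> w; rewrite mem_cat => /orP[/cP|/cP'].
- move=> _ [c cP <-]; exists (rev (map (@invw A) c)).
    move=> w; rewrite mem_rev => /mapP[v /cP[h hhs [->|->]] ->]; exists h => //.
      by right.
    left; rewrite /invw map_rev revK -map_comp map_id_in // => -[a b] _.
    by rewrite /inv_letter /= negbK.
  elim: c {cP} => [|w c IH]; first by rewrite mu_nil invg1.
  by rewrite map_cons rev_cons flatten_rcons !mu_cat IH mu_invw -invgM.
Qed.

End Generated.

Section Uniform.
Variables (A : finType) (G : groupType) (mu : word A -> G) (L : set (word A)).
Variables (D : automatic_data A) (hs : seq (word A)).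
Hypotheses (muP : marking mu) (DP : automatic_structure mu L D).
Implicit Types (u v w x y : word A) (l : letter A).

Let Dt := enc_automatic_data D.
Let ht := enc_seq (@enc_word A) hs.
Let ew := @enc_word A.
Let el := @enc_letter A.
Let H := generated mu hs.
Let run d w := foldl (dstep d) start (map el w).

Lemma multiplierP a u v : L u -> L v -> mu (u ++ seq_of_opt a) = mu v ->
  accepted (multiplier D a) (pad u v).
Proof. by case: DP => _ _ _ -> ? ? ?; exists u, v. Qed.

Lemma multiplier_inv a z : accepted (multiplier D a) z ->
  exists u v, [/\ L u, L v, mu (u ++ seq_of_opt a) = mu v & z = pad u v].
Proof. by case: DP => _ _ _ ->. Qed.

Lemma L_representative g : exists2 w, L w & mu w = g.
Proof.
case: DP => _ _ muL _; have : (mu @` L) g by rewrite muL.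
by case=> w; exists w.
Qed.

Lemma acceptorP t : accb (hd Dt) t <-> exists2 w, t = ew w & L w.
Proof.
rewrite accbP (@taccepted_enc (letter A)); case: DP => -> _ _ _.
split=> [[w tw Lw]|[w -> Lw]]; exists w => //; last by rewrite lst_enc_seq.
by rewrite -[t]lstK tw /ew /enc_word enc_seqE.
Qed.

Lemma cayley_sound Z t : cayley_ok Dt Z -> t \in lst (cayley Z) ->
  exists u l v, [/\ L u, L v, (mu u * mu [:: l])%g = mu v &
    t = Node (Node (ew u) (el l)) (ew v)].
Proof.
move=> /allP Zok; rewrite mkK => /mapP[e /Zok /hasP[m /enc_multipliers[a ->]]].
move=> /andP[/= /eqP al]; case: a al => [l|//] /= [le].
case/accbP/taccepted_enc => z ez /multiplier_inv[u [v [Lu Lv uv zE]]] ->.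
rewrite zE in ez; exists u, l, v; rewrite (unpad1_enc ez) (unpad2_enc ez) -le.
by split=> //; rewrite -mu_cat.
Qed.

(** The first alternative is needed because an empty path carries no edge, hence no evidence that
    its endpoint encodes a word of [L]. *)
Lemma tpath_sound Z p (s : seq tree) q : cayley_ok Dt Z -> tpath (cayley Z) p s q ->
  s = [::] /\ p = q \/ exists u w v, [/\ L u, L v, (mu u * mu w)%g = mu v &
    [/\ p = ew u, s = map el w & q = ew v]].
Proof.
move=> Zok; elim: s p => [|t s IH] p /=; first by left.
case=> e /(cayley_sound Zok)[u [l [v [Lu Lv uv ->]]]] /= [<- <- /IH vq]; right.
case: vq => [[-> <-]|[v' [w' [v'' [Lv' Lv'' e' [/enc_word_inj vv' -> ->]]]]]].
  by exists u, [:: l], v.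
by exists u, (l :: w'), v''; split=> //; rewrite mu_cons // mulgA uv vv'.
Qed.

Lemma gens_sound c :
  all (fun g => has (fun h => (g == h) || (g == tinv h)) (lst ht)) (lst c) ->
  exists2 w, lst (tflatten c) = map el w & H (mu w).
Proof.
rewrite lst_tflatten => /allP cP.
suff [c' c'P cE] : exists2 c', gen_list hs c' & lst c = map ew c'.
  exists (flatten c'); last exact: gen_list_generated.
  by rewrite cE -map_comp map_flatten; congr flatten; apply: eq_map => w; exact: lst_enc_seq.
elim: (lst c) cP => [|g s IH] cP; first by exists [::].
have [t ts|c' c'P sE] := IH; first by apply: cP; rewrite inE ts orbT.
have /hasP[h + gh] := cP g (mem_head _ _).
rewrite lst_enc_seq => /mapP[h' hs' hE].
have [w wh gw] : exists2 w, w = h' \/ w = invw h' & g = ew w.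
  case/orP: gh => /eqP->; first by exists h'; [left|].
  by exists (invw h'); [right|rewrite hE tinv_enc].
exists (w :: c'); last by rewrite gw sE.
by move=> v /[!inE] /orP[/eqP->|/c'P //]; exists h'.
Qed.

(** From the same [u], both x l and c y lead to [v]; cancelling [u] gives x l = c y in the group,
    with c in [H]. *)
Lemma edge_sound Z e s x l : cayley_ok Dt Z -> edge_ok ht (cayley Z) e ->
  hd (hd e) = Node s (el l) -> tl s = ew x ->
  exists2 y, tl (tl (hd e)) = ew y & H (mu (rcons x l) * (mu y)^-1)%g.
Proof.
rewrite /edge_ok => Zok + eE sx; rewrite eE /= sx.
set t := tl (tl (hd e)).
case/and3P=> /gens_sound[c cE Hc] /reachP/(tpath_sound Zok) r1 /reachP/(tpath_sound Zok).
rewrite !mkK cE /= {cE}.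
have {r1} [u [v [Lu Lv uv [-> ->]]]] : exists u v, [/\ L u, L v,
    (mu u * mu (rcons x l))%g = mu v & hd (tl (tl e)) = ew u /\ tl (tl (tl e)) = ew v].
  case: r1 => [[]|[u [w [v [Lu Lv uv [uE wE vE]]]]]].
    by rewrite mkK; case: (lst (ew x)).
  exists u, v; split=> //; rewrite -uv; congr (_ * mu _)%g.
  apply: (inj_map (@enc_letter_inj A)); rewrite -[RHS]wE mkK map_rcons -cats1.
  by rewrite /ew /enc_word lst_enc_seq.
(* Unlike x l, the word c y may be empty; then [y] is empty and the endpoints coincide. *)
move=> r2; have [y tE yc] : exists2 y, lst t = map el y & (mu u * mu (c ++ y))%g = mu v.
  case: r2 => [[]|[u' [w [v' [Lu' Lv' uv' [/enc_word_inj uu wE /enc_word_inj vv]]]]]].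
    move=> ct /enc_word_inj ->; exists [::]; last first.
      by case: (c) ct => //; rewrite (mu_nil muP) mulg1.
    by case: (lst t) ct => //; case: (c).
  exists (drop (size c) w).
    by rewrite map_drop -wE drop_size_cat ?size_map.
  rewrite uu vv -uv'; congr (_ * mu _)%g; apply: (inj_map (@enc_letter_inj A)).
  by rewrite map_cat map_drop -wE -/el drop_size_cat ?size_map.
exists y; first by rewrite -[t]lstK tE /ew /enc_word enc_seqE.
have := etrans yc (esym uv) => /mulgI <-.
by rewrite (mu_cat muP) mulgK.
Qed.

Lemma run_sound Z E w : cayley_ok Dt Z -> all (edge_ok ht (cayley Z)) (lst E) ->
  run (tmap hd E) w != Leaf ->
  exists2 x, tl (run (tmap hd E) w) = ew x & H (mu w * (mu x)^-1)%g.
Proof.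
move=> Zok /allP Eok; have [H1 HM HV] := generated_subgroup mu hs.
elim/last_ind: w => [|w l IH].
  by exists [::]; rewrite // (mu_nil muP) invg1 mulg1.
rewrite /run map_rcons foldl_rcons -/(run _ _) => /dstep_mem[/IH[x xE Hx]].
case=> e; rewrite mkK => /mapP[e' /Eok e'ok ->] [eE <-].
have [y yE Hy] := edge_sound Zok e'ok eE xE.
exists y => //; apply: generatedM Hy; rewrite !(mu_rcons muP).
exact: generatedMr.
Qed.

Lemma multb_sound a d (y y' : tree) I :
  mult_at Dt (enc_option (@enc_letter A) a) (multb d y y' I) ->
  forall u v, L u -> L v -> mu (u ++ seq_of_opt a) = mu v ->
  (run d u == y) = (run d v == y').
Proof.
move/mult_atP => inv u v Lu Lv uv.
have acc : taccepted (enc_automaton (@enc_padded A) (multiplier D a))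
    (map (@enc_padded A) (pad u v)).
  by apply/taccepted_enc; exists (pad u v) => //; apply: multiplierP.
by have /eqP := invb_sound inv acc; rewrite foldl_pstep2 pad1 pad2.
Qed.

(** Induction along the path labeled [h]: each letter is crossed through an L-representative of the
    product reached, and the multiplier of 1 settles the empty path. *)
Lemma core_sound d I0 K h : mult_at Dt Leaf (multb d start start I0) ->
  all (core_ok Dt d) (lst K) -> reach (tmap hd K) start (ew h) start ->
  forall u v, L u -> L v -> (mu u * mu h)%g = mu v ->
  (run d u == start) = (run d v == start).
Proof.
move=> ok0 /allP Kok /reachP; rewrite /ew /enc_word lst_enc_seq.
(* Only the origin of the path and the state expected of [u] are generalized; the state expected of
   [v] remains [start]. *)
move: {1 3}start => y; elim: h y => [|l h IH] y /=.
  move=> -> u v Lu Lv uv; apply: (@multb_sound None) ok0 _ _ Lu Lv _.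
  by rewrite cats0 -uv (mu_nil muP) mulg1.
case=> t; rewrite mkK => /mapP[e /Kok eok ->] [<- le pathe] u v Lu Lv uv.
have [w Lw uw] := L_representative (mu (rcons u l)).
move: eok; rewrite /core_ok le => /(@multb_sound (Some l)) /(_ u w Lu Lw) ->.
  by apply: IH => //; rewrite -uv uw (mu_rcons muP) -mulgA -(mu_cons muP).
by rewrite uw -cats1.
Qed.

(** The certificate makes the words of [L] leading to [start] exactly the L-representatives of
    elements of [H]. Both claims follow, as there are finitely many states. *)
Lemma check_sound c : check (Node Dt ht) c ->
  quasi_convex mu L H /\
  (finitely_many_representatives mu L ->
   (hd (tl (tl (tl (tl (tl c))))) != Leaf <-> finite_set H)).
Proof.
rewrite /check /check_data; set Z := hd c; set u0 := hd (tl c); set E := hd (tl (tl c)).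
set K := hd _; set I0 := hd _; set f := tl _; rewrite /=.
set d := tmap hd E.
case/and5P=> Zok /acceptorP[w0 w0E Lw0] /reachP r0 Eok.
case/and5P=> Kok ok0 gens /eqP run0 fin.
(* The path from [w0] to [w0] labeled [w0] gives w0 w0 = w0. *)
have w0_1 : mu w0 = 1%g.
  case: (tpath_sound Zok r0) => [[+ _]|[u [w [v [_ _ uv [+ + +]]]]]].
    by rewrite w0E /ew /enc_word lst_enc_seq; case: (w0) => // _; exact: mu_nil.
  rewrite w0E => /enc_word_inj uE + /enc_word_inj vE.
  rewrite /ew /enc_word lst_enc_seq => /(inj_map (@enc_letter_inj A)) wE.
  by move: uv; rewrite -uE -vE -wE -[RHS]mulg1 => /mulgI.
have run_w0 : run d w0 = start.
  by rewrite -[RHS]run0 w0E /ew /enc_word lst_enc_seq.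
have [H1 HM HV] := generated_subgroup mu hs.
(* The elements whose right multiplication preserves the property of leading to [start] form a
   subgroup containing the generators, hence all of [H]. The word [w0] then serves as origin. *)
pose P g := forall u v, L u -> L v -> (mu u * g)%g = mu v ->
  (run d u == start) = (run d v == start).
have HP g : H g -> P g.
  move=> Hg; apply: (Hg P); split; first split.
  - move=> u v Lu Lv uv; apply: (core_sound (h := [::]) ok0 Kok _ Lu Lv).
      by apply/reachP.
    by rewrite (mu_nil muP).
  - move=> g1 g2 P1 P2 u v Lu Lv uv.
    have [w Lw uw] := L_representative (mu u * g1)%g.
    by rewrite (P1 u w) // (P2 w v) // uw -mulgA.
  - move=> g1 P1 u v Lu Lv uv; apply/esym/P1 => //.
    by rewrite -uv mulgVK.
  - move=> _ [h hhs <-] u v Lu Lv uv; apply: core_sound ok0 Kok _ _ _ Lu Lv uv.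
    by move/allP: gens; apply; rewrite lst_enc_seq map_f.
have LH w : L w -> (H (mu w) <-> run d w = start).
  move=> Lw; split=> [/HP/(_ w0 w Lw0 Lw)|rw].
    by rewrite w0_1 mul1g run_w0 eqxx => /(_ erefl)/esym/eqP.
  have [|x] := run_sound (w := w) Zok Eok; first by rewrite -/d rw.
  by rewrite -/d rw => /(@enc_word_inj _ [::]) <-; rewrite (mu_nil muP) invg1 mulg1.
split; last first.
  move=> fr; rewrite (finb_sound fin); case: DP => accL _ muL _.
  rewrite (@bounded_enc _ L _ (fun w => H (mu w)) d start accL LH).
  exact: bounded_representatives.
(* The constant is the length of the longest state: a prefix leading to [x] lies in the coset H x,
   so the inverse of [x] brings it back to [H]. *)
exists (\max_(s <- [:: start, Leaf & map tl (lst d)]) size (lst (tl s))).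
move=> w Lw /(LH w Lw) rw i _.
have nz : run d (take i w) != Leaf.
  apply/eqP => E0; move: rw; rewrite -{1}[w](cat_take_drop i) /run map_cat foldl_cat.
  by rewrite -/(run d _) E0 foldl_dstep_leaf.
have [x xE Hx] := run_sound Zok Eok nz.
exists (mu (take i w) * (mu x)^-1)%g => //; exists (invw x); last by rewrite (mu_invw muP).
rewrite size_rev size_map.
have -> : size x = size (lst (tl (run d (take i w)))).
  by rewrite -/d in xE; rewrite xE /ew /enc_word lst_enc_seq size_map.
apply: (@leq_bigmax_seq _ _ _ (fun s => size (lst (tl s)))) => //.
exact: foldl_dstep_states.
Qed.

End Uniform.

(** * Existence of certificates *)

Lemma tpath_sub T T' p s q : {subset lst T <= lst T'} -> tpath T p s q -> tpath T' p s q.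
Proof.
move=> sub; elim: s p => //= x s IH p [t tT [tp tx /IH tq]].
by exists t; first exact: sub.
Qed.

Lemma cayley_sub Z Z' : {subset lst Z <= lst Z'} ->
  {subset lst (cayley Z) <= lst (cayley Z')}.
Proof. by move=> sub t; rewrite !mkK => /mapP[e /sub eZ ->]; apply: map_f. Qed.

Lemma reach_sub Z Z' u w v : {subset lst Z <= lst Z'} ->
  reach (cayley Z) u w v -> reach (cayley Z') u w v.
Proof. by move=> sub /reachP r; apply/reachP; apply: tpath_sub r; exact: cayley_sub. Qed.

(** Each transition is proved with its own edges of the Cayley graph; monotonicity allows pooling
    them in one list. *)
Lemma edge_ok_sub hs Z Z' e : {subset lst Z <= lst Z'} ->
  edge_ok hs (cayley Z) e -> edge_ok hs (cayley Z') e.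
Proof.
by move=> sub /and3P[? r1 r2]; apply/and3P; split=> //; [move: r1|move: r2]; exact: reach_sub.
Qed.

Lemma cayley_ok_cat D Z Z' : cayley_ok D Z -> cayley_ok D Z' -> cayley_ok D (tcat Z Z').
Proof. by rewrite /cayley_ok mkK all_cat => -> ->. Qed.

Section Completeness.
Variables (A : finType) (G : groupType) (mu : word A -> G) (L : set (word A)).
Variables (D : automatic_data A) (hs : seq (word A)).
Hypotheses (muP : marking mu) (DP : automatic_structure mu L D).
Implicit Types (u v w x : word A) (l : letter A) (g : G) (k : nat).

Let Dt := enc_automatic_data D.
Let ht := enc_seq (@enc_word A) hs.
Let ew := @enc_word A.
Let el := @enc_letter A.
Let H := generated mu hs.
Let run d w := foldl (dstep d) start (map el w).
Let L_rep := L_representative DP.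

Lemma cayley_edge u l v : L u -> L v -> (mu u * mu [:: l])%g = mu v ->
  exists2 Z, cayley_ok Dt Z & Node (Node (ew u) (el l)) (ew v) \in lst (cayley Z).
Proof.
move=> Lu Lv uv; pose z := mk (map (@enc_padded A) (pad u v)).
have zE : lst z = map (@enc_padded A) (pad u v) by rewrite mkK.
exists (Node (Node (el l) z) Leaf); last first.
  by rewrite mkK /= (unpad1_enc zE) (unpad2_enc zE) mem_head.
rewrite /cayley_ok /= andbT; apply/hasP.
exists (Node (enc_option (@enc_letter A) (Some l))
  (enc_automaton (@enc_padded A) (multiplier D (Some l)))).
  by apply/enc_multipliers; exists (Some l).
rewrite /= eqxx; apply/accbP/taccepted_enc; exists (pad u v) => //.
by apply: (multiplierP DP) => //; rewrite (mu_cat muP).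
Qed.

(** The last hypothesis is there because an empty path joins a word to itself, whereas one group
    element may have several L-representatives. *)
Lemma reach_complete u w v : L u -> L v -> (mu u * mu w)%g = mu v ->
  (w = [::] -> u = v) ->
  exists2 Z, cayley_ok Dt Z & reach (cayley Z) (ew u) (ew w) (ew v).
Proof.
elim: w u => [|l w IH] u Lu Lv uv wv.
  by exists Leaf => //; apply/reachP; rewrite wv.
have [v' Lv' [uv' wv']] : exists2 v', L v' &
    (mu u * mu [:: l])%g = mu v' /\ (w = [::] -> v' = v).
  case: w {IH wv} uv => [|l' w] uv; first by exists v.
  by have [v' Lv' v'E] := L_rep (mu u * mu [:: l])%g; exists v'.
have [Z1 Z1ok r1] := cayley_edge Lu Lv' uv'.
have [|Z2 Z2ok /reachP r2] := IH v' Lv' Lv _ wv'.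
  by rewrite -uv' -mulgA -(mu_cons muP).
exists (tcat Z1 Z2); first exact: cayley_ok_cat.
apply/reachP; move: r2; rewrite /ew /enc_word !lst_enc_seq /= => r2.
exists (Node (Node (ew u) (el l)) (ew v')).
  by move: r1; apply: cayley_sub => t tZ; rewrite mkK mem_cat tZ.
split=> //; move: r2; apply: tpath_sub; apply: cayley_sub => t tZ.
by rewrite mkK mem_cat tZ orbT.
Qed.

Lemma edge_complete x l y : H (mu (rcons x l) * (mu y)^-1)%g ->
  exists e Z, [/\ cayley_ok Dt Z, edge_ok ht (cayley Z) e &
    hd e = Node (Node (Node Leaf (ew x)) (el l)) (Node Leaf (ew y))].
Proof.
move=> /(generated_gen_list muP)[c cP cE].
have [u Lu u1] := L_rep 1%g.
(* If x l is 1 in the group, the word c y may be empty, so [v] has to be [u] itself. *)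
have [v Lv [uv v1]] : exists2 v, L v &
    (mu u * mu (rcons x l))%g = mu v /\ (mu (rcons x l) = 1%g -> u = v).
  have [e1|ne] := pselect (mu (rcons x l) = 1%g); first by exists u; rewrite ?e1 ?mulg1.
  by have [v Lv vE] := L_rep (mu u * mu (rcons x l))%g; exists v.
have [|Z1 Z1ok r1] := reach_complete Lu Lv uv; first by case: (x).
have cyE : mu (flatten c ++ y) = mu (rcons x l) by rewrite (mu_cat muP) cE mulgVK.
have [||Z2 Z2ok r2] := @reach_complete u (flatten c ++ y) v Lu Lv.
- by rewrite cyE.
- by move=> cy; apply: v1; rewrite -cyE cy (mu_nil muP).
exists (Node (Node (Node (Node Leaf (ew x)) (el l)) (Node Leaf (ew y)))
  (Node (mk (map ew c)) (Node (ew u) (ew v)))), (tcat Z1 Z2); split=> //.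
  exact: cayley_ok_cat.
rewrite /edge_ok /=; apply/and3P; split.
- rewrite mkK; apply/allP => _ /mapP[w /cP[h hhs wh] ->]; apply/hasP; exists (ew h).
    by rewrite lst_enc_seq map_f.
  by rewrite tinv_enc; case: wh => ->; rewrite eqxx ?orbT.
- have -> : tcat (ew x) (Node (el l) Leaf) = ew (rcons x l).
    by rewrite /tcat /ew /enc_word lst_enc_seq enc_seqE map_rcons cats1.
  by apply: reach_sub r1 => t tZ; rewrite mkK mem_cat tZ.
- have -> : tcat (tflatten (mk (map ew c))) (ew y) = ew (flatten c ++ y).
    rewrite /tcat lst_tflatten mkK /ew /enc_word lst_enc_seq enc_seqE map_cat map_flatten.
    rewrite -map_comp; congr (mk (flatten _ ++ _)); apply: eq_map => w.
    exact: lst_enc_seq.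
  by apply: reach_sub r2 => t tZ; rewrite mkK mem_cat tZ orbT.
Qed.

Lemma edges_complete (keys : seq (word A * letter A)) (f : word A -> letter A -> word A) :
  (forall x l, (x, l) \in keys -> H (mu (rcons x l) * (mu (f x l))^-1)%g) ->
  exists E Z, [/\ cayley_ok Dt Z, all (edge_ok ht (cayley Z)) (lst E) &
    map hd (lst E) = [seq Node (Node (Node Leaf (ew p.1)) (el p.2))
                               (Node Leaf (ew (f p.1 p.2))) | p <- keys]].
Proof.
elim: keys => [|[x l] keys IH] fP; first by exists Leaf, Leaf.
have [|E [Z [Zok Eok EE]]] := IH.
  by move=> x' l' k'; apply: fP; rewrite inE k' orbT.
have [e [Z' [Zok' eok eE]]] := edge_complete (fP x l (mem_head _ _)).
exists (Node e E), (tcat Z Z'); split; [exact: cayley_ok_cat| |by rewrite /= EE eE].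
rewrite /= (edge_ok_sub _ eok) /=; last by move=> t tZ; rewrite mkK mem_cat tZ orbT.
by apply: sub_all Eok => e'; apply: edge_ok_sub => t tZ; rewrite mkK mem_cat tZ.
Qed.

Lemma multb_complete a d (y y' : tree) :
  (forall u v, L u -> L v -> mu (u ++ seq_of_opt a) = mu v ->
    (run d u == y) = (run d v == y')) ->
  exists I, mult_at Dt (enc_option (@enc_letter A) a) (multb d y y' I).
Proof.
move=> h; pose F0 := [:: start, Leaf & map tl (lst d)].
have F0step s p : s \in F0 -> pstep d s p \in F0.
  by rewrite /pstep; case: ifP => // _ _; rewrite inE dstep_states orbT.
have [|||I iI] := @invb_complete (pstep2 d)
    (fun ss => (hd ss == y) == (tl ss == y')) (Node start start)
    (enc_automaton (@enc_padded A) (multiplier D a)) [seq Node s s' | s <- F0, s' <- F0].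
- by apply/allpairsP; exists (start, start); rewrite !mem_head.
- move=> ss p /allpairsP[[s s'] [sF s'F ->]]; apply/allpairsP.
  by exists (pstep d s (hd p), pstep d s' (tl p)); split=> //; exact: F0step.
- move=> _ /taccepted_enc[_ -> /(multiplier_inv DP)[u [v [Lu Lv uv ->]]]].
  by rewrite foldl_pstep2 pad1 pad2 /=; apply/eqP; exact: h.
- by exists I; apply/mult_atP.
Qed.

(** After the first [i] symbols of the padded pair, the multiplier automaton can reach a final state
    by a short word. The pair so completed is again accepted and extends both prefixes by short
    tails. *)
Lemma fellow_traveller : exists C, forall l u v, L u -> L v ->
  (mu u * mu [:: l])%g = mu v -> forall i, exists2 x, size x <= C &
  mu (take i v) = (mu (take i u) * mu x)%g.
Proof.
suff h l : exists C, forall u v, L u -> L v ->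
    (mu u * mu [:: l])%g = mu v -> forall i, exists2 x, size x <= C &
    mu (take i v) = (mu (take i u) * mu x)%g.
  have [f fP] := choice h; exists (\max_l f l) => l u v Lu Lv uv i.
  have [x xf xE] := fP l u v Lu Lv uv i; exists x => //.
  exact: leq_trans xf (leq_bigmax _).
pose M := enc_automaton (@enc_padded A) (multiplier D (Some l)).
pose R r s := exists2 q, q \in lst (hd (tl M)) & tpath (tl (tl M)) r s q.
(* One bound for all states from which a final state can be reached. *)
have [N NP] : exists N, forall r, r \in lst (hd M) ++ map tl (lst (tl (tl M))) ->
    (exists s, R r s) -> exists2 s, size s <= N & R r s.
  elim: (_ ++ _) => [|r Q [N IH]]; first by exists 0.
  have [[s Rs]|no] := pselect (exists s, R r s).
    exists (maxn N (size s)) => r' /[!inE] /orP[/eqP-> _|r'Q /IH{IH}]; last first.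
      by case=> // t tN Rt; exists t => //; rewrite leq_max tN.
    by exists s; rewrite ?leq_maxr.
  by exists N => r' /[!inE] /orP[/eqP->|r'Q]; [move=> /no|exact: IH].
exists (N + N.+1) => u v Lu Lv uv i.
have acc : taccepted M (map (@enc_padded A) (pad u v)).
  apply/taccepted_enc; exists (pad u v) => //.
  by apply: (multiplierP DP) => //; rewrite (mu_cat muP).
case: acc => p [q [pi qf]].
rewrite -{1}[pad u v](cat_take_drop i) map_cat => /tpath_cat[r pr rq].
have rQ : r \in lst (hd M) ++ map tl (lst (tl (tl M))).
  by rewrite mem_cat; case: (tpath_states pr) => ->; rewrite ?pi ?orbT.
have [|s sN [q' qf' rq']] := NP r rQ; first by eexists; exists q; eauto.
have : taccepted M (map (@enc_padded A) (take i (pad u v)) ++ s).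
  by exists p, q'; split=> //; apply/tpath_cat; exists r.
case/taccepted_enc => z zE /(multiplier_inv DP)[u' [v' [Lu' Lv' uv' zE']]].
have enc_inj : injective (@enc_padded A).
  by apply: enc_pair_inj; apply: enc_option_inj; exact: enc_letter_inj.
pose n := size (take i (pad u v)).
have zt : take n z = take i (pad u v).
  apply: (inj_map enc_inj).
  by rewrite map_take -zE take_size_cat // size_map.
have zs : size (drop n z) = size s.
  by rewrite -(size_map (@enc_padded A)) map_drop -zE drop_size_cat // size_map.
have u'E : u' = take i u ++ pmap fst (drop n z).
  by rewrite -[u'](pad1 _ v') -zE' -(take_pad1 u v i) -zt -pmap_cat cat_take_drop.
have v'E : v' = take i v ++ pmap snd (drop n z).
  by rewrite -[v'](pad2 u') -zE' -(take_pad2 u v i) -zt -pmap_cat cat_take_drop.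
(* The tail of [u'], the letter [l], then the inverse of the tail of [v'], whence the bound
   [N + N.+1]. *)
exists (pmap fst (drop n z) ++ l :: invw (pmap snd (drop n z))).
  rewrite size_cat /= size_rev size_map !size_pmap -zs in sN *.
  by rewrite leq_add ?ltnS //; apply: leq_trans (count_size _ _) _.
move: uv'; rewrite u'E v'E !(mu_cat muP) (mu_cons muP) (mu_invw muP) !mulgA => ->.
by rewrite mulgK.
Qed.

End Completeness.

(** * A ball of the Schreier graph as a certificate *)

Section CheckComplete.
Variables (A : finType) (G : groupType) (mu : word A -> G) (L : set (word A)).
Variables (D : automatic_data A) (hs : seq (word A)).
Hypotheses (muP : marking mu) (DP : automatic_structure mu L D).
Implicit Types (u v w x p : word A) (l : letter A) (g : G) (k : nat).

Let Dt := enc_automatic_data D.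
Let ht := enc_seq (@enc_word A) hs.
Let ew := @enc_word A.
Let el := @enc_letter A.
Let H := generated mu hs.
Let run d w := foldl (dstep d) start (map el w).
Let L_rep := L_representative DP.
Let HV := generatedV (mu := mu) (hs := hs).
Let HM := generatedM (mu := mu) (hs := hs).
Let HMr := generatedMr (mu := mu) (hs := hs).

(** The representatives in [L] of elements of the coset H g pass only through cosets H x with [x] of
    length at most [k]. *)
Definition near g k := forall w, L w -> H (mu w * g^-1)%g -> forall i,
  exists2 x, size x <= k & H (mu x * (mu (take i w))^-1)%g.

(** Induction on the length of [p]: quasi-convexity is the empty case, and each further letter costs
    one fellow traveller constant. *)
Lemma near_words m : quasi_convex mu L H ->
  exists k, forall p, size p <= m -> near (mu p) k.
Proof.
case=> k0 qc; have [C CP] := fellow_traveller muP DP.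
elim: m => [|m [k IH]].
  exists k0 => -[|//] _ w Lw; rewrite (mu_nil muP) invg1 mulg1 => Hw i.
  wlog iw : i / i <= size w.
    move=> h; have [/h//|/ltnW wi] := leqP i (size w).
    by rewrite take_oversize // -[w]take_size; apply: h.
  have [h Hh [x xk hE]] := qc w Lw Hw i iw.
  exists (invw x); first by rewrite size_rev size_map.
  have [_ _ HV1] := generated_subgroup mu hs.
  by rewrite (mu_invw muP) -invgM -hE; exact: HV1.
exists (k + C) => p; rewrite leq_eqVlt => /orP[/eqP|/IH np]; last first.
  move=> w Lw Hw i; have [x xk Hx] := np w Lw Hw i; exists x => //.
  exact: leq_trans xk (leq_addr _ _).
elim/last_ind: p => // p l _ [/[!size_rcons] -[pm]] w Lw Hw i.
have [w' Lw' w'E] := L_rep (mu w * (mu [:: l])^-1)%g.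
have w'l : (mu w' * mu [:: l])%g = mu w by rewrite w'E mulgVK.
have Hw' : H (mu w' * (mu p)^-1)%g.
  by move: Hw; rewrite (mu_rcons muP) invgM mulgA -w'E.
have [y yk Hy] := IH p (eq_leq pm) w' Lw' Hw' i.
have [x xC xE] := CP l w' w Lw' Lw w'l i.
exists (y ++ x); first by rewrite size_cat leq_add.
by rewrite xE (mu_cat muP); exact: HMr.
Qed.

(** The states are chosen short representatives of the cosets met in the ball of radius [k], and the
    transitions are all those which stay in it. *)
Lemma check_complete : quasi_convex mu L H -> exists c, check (Node Dt ht) c.
Proof.
move=> qc; have [H1 _ _] := generated_subgroup mu hs.
pose m := \max_(h <- hs) size h.
(* The core transitions go from words of length at most [m] to their one-letter extensions, hence
   [m.+1]. *)
have [k nearP] := near_words m.+1 qc.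
pose ball g := exists2 x, size x <= k & H (mu x * g^-1)%g.
(* [H] itself is represented by the empty word, so that its state is [start]; the default of [nth]
   matters only outside the ball. *)
pose canon g := if `[< H g >] then [::] else
  nth [::] (words_upto A k) (find (fun x => `[< H (mu x * g^-1)%g >]) (words_upto A k)).
have canon_coset g h : H (g * h^-1)%g -> canon g = canon h.
  move=> gh; rewrite /canon.
  have -> : `[< H g >] = `[< H h >].
    apply: asbool_equiv_eq; rewrite -[g]mulg1 -[h]mulg1 -invg1; split; last exact: HM.
    by apply: HM; exact: HV.
  congr (if _ then _ else nth _ _ _); apply: eq_find => x.
  by apply: asbool_equiv_eq; split=> /HM; apply=> //; exact: HV.
have ball_coset g h : H (g * h^-1)%g -> ball g -> ball h.
  by move=> gh [x xk /HM xg]; exists x => //; exact: xg.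
have canonP g : ball g -> size (canon g) <= k /\ H (mu (canon g) * g^-1)%g.
  move=> [x xk xg]; rewrite /canon; case: asboolP => [Hg|_].
    by rewrite (mu_nil muP); split=> //; apply: HV; rewrite invg1 mulg1.
  set P := fun x => _; have ex : has P (words_upto A k).
    by apply/hasP; exists x; rewrite ?mem_words_upto //; exact/asboolP.
  split; first by rewrite -mem_words_upto mem_nth // -has_find.
  by have /asboolP := nth_find [::] ex.
have canon1 : canon 1%g = [::] by rewrite /canon; case: asboolP.
pose st g := Node Leaf (ew (canon g)).
have st1 : st 1%g = start by rewrite /st canon1.
pose keys := [seq q <- [seq (x, l) | x <- words_upto A k, l <- enum (letter A)] |
  `[< ball (mu (rcons q.1 q.2)) >]].
have keysP x l : (x, l) \in keys <-> size x <= k /\ ball (mu (rcons x l)).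
  rewrite mem_filter -mem_words_upto; split=> [/andP[/asboolP b /allpairsP[q [qk _ [xE _]]]]|].
    by split; first rewrite xE.
  case=> xk b; apply/andP; split; first exact/asboolP.
  by apply/allpairsP; exists (x, l); rewrite mem_enum.
have [|E [Z [Zok Eok EE]]] := @edges_complete _ _ _ _ _ hs muP DP keys
    (fun x l => canon (mu (rcons x l))).
  by move=> x l /keysP[_ /canonP[_ /HV]].
pose d := tmap hd E.
have dP e : e \in lst d <-> exists x l, [/\ size x <= k, ball (mu (rcons x l)) &
    e = Node (Node (Node Leaf (ew x)) (el l)) (st (mu (rcons x l)))].
  rewrite mkK EE; split=> [/mapP[[x l] /keysP[xk b] ->]|[x [l [xk b ->]]]].
    by exists x, l.
  by apply/mapP; exists (x, l) => //; apply/keysP.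
have rcons_coset x w l : H (mu x * (mu w)^-1)%g ->
    H (mu (rcons x l) * (mu (rcons w l))^-1)%g.
  by rewrite !(mu_rcons muP); exact: HMr.
have run_ball w : (forall i, ball (mu (take i w))) -> run d w = st (mu w).
  elim/last_ind: w => [|w l IH] bw; first by rewrite (mu_nil muP) st1.
  have {}IH : run d w = st (mu w).
    apply: IH => i; have [iw|wi] := leqP i (size w).
      by have := bw i; rewrite -cats1 takel_cat.
    by have := bw (size w); rewrite -cats1 take_size_cat // take_oversize // ltnW.
  have /canonP[xk Hx] : ball (mu w).
    by have := bw (size w); rewrite -cats1 take_size_cat.
  have bl : ball (mu (rcons w l)) by have := bw (size (rcons w l)); rewrite take_size.
  have Hxl := rcons_coset _ _ l Hx.
  rewrite /run map_rcons foldl_rcons -/(run d w) IH.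
  rewrite (@dstep_uniq _ _ _ (Node (Node (st (mu w)) (el l)) (st (mu (rcons w l))))) //.
    apply/dP; exists (canon (mu w)), l; split=> //.
      by apply: ball_coset bl; exact: HV.
    by rewrite /st (canon_coset _ _ Hxl).
  move=> _ /dP[x [l' [_ _ ->]]] /= eE.
  have /enc_letter_inj -> := congr1 tl eE.
  have /enc_word_inj -> := congr1 (fun t => tl (hd t)) eE.
  by rewrite /st (canon_coset _ _ Hxl).
have run_canon w : run d w != Leaf -> run d w = st (mu w) /\ ball (mu w).
  elim/last_ind: w => [_|w l IH].
    rewrite (mu_nil muP) st1; split=> //; exists [::] => //.
    by rewrite (mu_nil muP) invg1 mulg1.
  rewrite /run map_rcons foldl_rcons -/(run d w).
  move=> /dstep_mem[/IH[-> /canonP[xk Hx]] [_ /dP[x [l' [_ bxl ->]]] [/= eE <-]]].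
  have ll := enc_letter_inj (congr1 tl eE).
  have xE := enc_word_inj (congr1 (fun t => tl (hd t)) eE).
  have Hxl := rcons_coset _ _ l Hx.
  rewrite ll xE in bxl *; split; last exact: ball_coset bxl.
  by rewrite /st (canon_coset _ _ Hxl).
have lang p w : size p <= m.+1 -> L w ->
    (run d w == st (mu p)) = `[< H (mu w * (mu p)^-1)%g >].
  move=> pm Lw; apply/eqP/asboolP => [rw|Hw].
    have /run_canon[rE /canonP[_ bw]] : run d w != Leaf by rewrite rw.
    (* Equal states mean equal cosets only inside the ball; the coset of [p] lies there as the
       endpoint of one of its L-representatives. *)
    have [w' Lw' w'p] := L_rep (mu p).
    have [|x xk] := nearP p pm w' Lw' _ (size w'); first by rewrite w'p mulgV.
    rewrite take_size w'p => Hx; have /canonP[_ bp] : ball (mu p) by exists x.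
    have cE : canon (mu p) = canon (mu w).
      by have /enc_word_inj := congr1 tl (etrans (esym rw) rE).
    by apply: HM bp; apply: HV; rewrite cE.
  rewrite run_ball; first by rewrite /st (canon_coset _ _ Hw).
  by move=> i; have [x xk Hx] := nearP p pm w Lw Hw i; exists x.
have stepP p a : size (p ++ seq_of_opt a) <= m.+1 -> size p <= m.+1 -> exists I,
    mult_at Dt (enc_option (@enc_letter A) a)
      (multb d (st (mu p)) (st (mu (p ++ seq_of_opt a))) I).
  move=> pam pm; apply: (multb_complete DP) => u v Lu Lv.
  rewrite !lang // => <-; apply: asbool_equiv_eq.
  by rewrite !(mu_cat muP) mulgKA.
have [I0 I0P] := stepP [::] None isT isT.
(* The bound on the length is put under the existential, so that a choice function is defined for
   all words, with [Leaf] as a dummy for long ones. *)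
have /choice[I IP] : forall q : word A * letter A, exists I, size q.1 <= m ->
    mult_at Dt (Node Leaf (el q.2))
      (multb d (st (mu q.1)) (st (mu (rcons q.1 q.2))) I).
  case=> p l; have [pm|] := leqP (size p) m; last by exists Leaf.
  have [||I IP] := stepP p (Some l); rewrite ?size_cat ?addn1 ?ltnS ?(ltnW pm) //.
    by rewrite leqW.
  by exists I => _; rewrite -cats1.
pose K := mk [seq Node (Node (Node (st (mu p)) (el l)) (st (mu (rcons p l)))) (I (p, l)) |
  p <- words_upto A m, l <- enum (letter A)].
have pathK h p : size (p ++ h) <= m ->
    tpath (tmap hd K) (st (mu p)) (map el h) (st (mu (p ++ h))).
  elim: h p => [|l h IH] p; first by rewrite cats0.
  rewrite -cat_rcons => pm; exists (Node (Node (st (mu p)) (el l)) (st (mu (rcons p l)))).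
    rewrite mkK; apply/mapP.
    exists (Node (Node (Node (st (mu p)) (el l)) (st (mu (rcons p l)))) (I (p, l))) => //.
    rewrite mkK; apply/allpairsP; exists (p, l); rewrite mem_words_upto mem_enum.
    by split=> //; apply: leq_trans pm; rewrite size_cat size_rcons addSn leqW ?leq_addr.
  by split=> //; exact: IH.
have [u Lu u1] := L_rep 1%g.
have [|//|Z0 Z0ok r0] := @reach_complete _ _ _ _ _ muP DP u u u Lu Lu.
  by rewrite u1 mulg1.
have [f fP] := finb_complete (hd Dt) d start.
exists (Node (tcat Z0 Z) (Node (ew u) (Node E (Node K (Node I0 f))))).
rewrite /check /check_data /= -/d; apply/and5P; split.
- exact: cayley_ok_cat.
- by apply/(acceptorP DP); exists u.
- by apply: reach_sub r0 => t tZ; rewrite mkK mem_cat tZ.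
- by apply: sub_all Eok => e; apply: edge_ok_sub => t tZ; rewrite mkK mem_cat tZ orbT.
apply/and5P; split=> //.
- rewrite mkK; apply/allP => _ /allpairsP[[p l] [/= pm _ ->]].
  by apply: (IP (p, l)); rewrite -mem_words_upto.
- by move: I0P; rewrite cats0 (mu_nil muP) st1.
- rewrite lst_enc_seq; apply/allP => _ /mapP[h hhs ->]; apply/reachP.
  have hm : size h <= m by exact: leq_bigmax_seq.
  have -> : lst (ew h) = map el h by rewrite /ew /enc_word lst_enc_seq.
  (* The path labeled by a generator [h] closes up since [h] lies in [H]. *)
  have := pathK h [::] hm; rewrite (mu_nil muP) st1.
  rewrite /st (canon_coset _ 1%g) ?canon1 // invg1 mulg1; exact: generated_gen.
- rewrite /ew /enc_word lst_enc_seq -/(run d u) -st1 -(mu_nil muP) lang //.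
  by apply/asboolP; rewrite u1 (mu_nil muP) invg1 mulg1.
Qed.

End CheckComplete.

Theorem proposition6p3 :
  (forall (A : finType) (G : groupType) (mu : word A -> G) (L : set (word A)),
     1 < #|A| -> marking mu ->
     rational_structure mu L ->
     stallings_computable mu L ->
     finitely_many_representatives mu L ->
     exists p : prog, solves_finiteness mu L p (enc_seq (@enc_word A))) /\
  (exists p : prog,
     forall (A : finType) (G : groupType) (mu : word A -> G) (L : set (word A)),
     1 < #|A| -> marking mu ->
     rational_structure mu L ->
     stallings_computable mu L ->
     finitely_many_representatives mu L ->
     forall D : automatic_data A, automatic_structure mu L D ->
     solves_finiteness mu L p
       (fun hs => Node (enc_automatic_data D) (enc_seq (@enc_word A) hs))).
Proof.
split=> [A G mu L _ _|]; first exact: finiteness_rational.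
(* The checker reads the automata from its input, so one program serves all automatic structures. *)
have [ps psP] := unbounded_search computableb_check.
have [po poP] : computable (fun c => enc_bool (hd (tl (tl (tl (tl (tl c))))) != Leaf)).
  by comp.
exists (PSeq ps po) => A G mu L _ muP _ _ fr D DP hs _.
have [fwd bwd] := psP (Node (enc_automatic_data D) (enc_seq (@enc_word A) hs)).
split=> [/(check_complete muP DP)/fwd[c cP ec]|nqc [y e]].
- exists (hd (tl (tl (tl (tl (tl c))))) != Leaf).
    by have [_] := check_sound muP DP cP; exact.
  by apply: (ESeq ec); exact: poP.
(* A halting run would provide a certificate, whose soundness contradicts the failure of
   quasi-convexity. *)
- have [|c /(check_sound muP DP)[]//] := bwd.
  by inversion e as [| | | | |p q x y' z e1 e2| | | |]; subst; exists y'.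
Qed.
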